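(* Suppose that (C1)–(C8) hold for a random open system $(\Omega,m,\sigma,\mathcal{J}_0,T,\mathcal{B},\mathcal{L}_0,\nu_0,\varphi_0,H_\epsilon)$ and there exists $A\in L^1(m)$ such that for $m$-a.e. $\omega\in\Omega$ and all $\epsilon>0$ sufficiently small $$\frac{\log\lambda_{\omega,0}-\log\lambda_{\omega,\epsilon}}{\mu_{\omega,0}(H_{\omega,\epsilon})}\le A(\omega).$$ Further suppose that there are $\kappa(\epsilon)$ with $\kappa(\epsilon)\to\infty$ as $\epsilon\to0$, $t\in L^\infty(m)$ with $t_\omega>0$, and $\xi_{\omega,\epsilon}\in L^\infty(m)$ with $\xi_{\omega,\epsilon}\to0$ as $\epsilon\to0$ for $m$-a.e. $\omega$ such that $$\mu_{\omega,0}(H_{\omega,\epsilon})=\frac{t_\omega+\xi_{\omega,\epsilon}}{\kappa(\epsilon)}$$ and $|\xi_{\omega,\epsilon}|<Ct_\omega$ for all $\epsilon>0$ sufficiently small for some $C>0$. Then for $m$-a.e. $\omega\in\Omega$ $$\lim_{\epsilon\to0}\frac{R_\epsilon(\mu_{\omega,0})}{\mu_{\omega,0}(H_{\omega,\epsilon})}=\frac{\int_\Omega\theta_{\omega,0}t_\omega\,dm(\omega)}{t_\omega},\qquad\theta_{\omega,0}=1-\sum_{k=0}^\infty\hat q^{(k)}_{\omega,0}.$$ In particular, if $t_\omega$ is constant $m$-a.e. then $$\lim_{\epsilon\to0}\frac{R_\epsilon(\mu_{\omega,0})}{\mu_{\omega,0}(H_{\omega,\epsilon})}=\int_\Omega\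theta_{\omega,0}\,dm(\omega).$$
   Context: Random open systems. $(\Omega,\mathscr{F},m)$ is a probability space and $\sigma:\Omega\to\Omega$ is an invertible, ergodic, $m$-preserving map. $X$ is a complete metrizable space with Borel $\sigma$-algebra $\mathscr{B}$; for each $\omega$, $\mathcal{J}_{\omega,0}\subseteq X$ is closed, $\omega\mapsto\mathcal{J}_{\omega,0}$ is a closed random set (i.e. measurable), and $T_\omega:\mathcal{J}_{\omega,0}\to\mathcal{J}_{\sigma\omega,0}$ is a map. Put $T_\omega^n=T_{\sigma^{n-1}\omega}\circ\cdots\circ T_\omega$, $\mathcal{J}_0=\bigcup_{\omega}\{\omega\}\times\mathcal{J}_{\omega,0}$ and $T(\omega,x)=(\sigma\omega,T_\omega(x))$ on $\mathcal{J}_0$. A random (probability) measure $\mu=\{\mu_\omega\}$ is a measure on $\Omega\times X$ with marginal $m$, identified with its disintegration into fibre (probability) measures $\mu_\omega$. $\{\mathcal{B}_\omega\}$ are Banach spaces of real-valued functions on $\mathcal{J}_{\omega,0}$, $g_{\omega,0}\in\mathcal{B}_\omega$ are weights, and $\mathcal{L}_{\omega,0}f(x)=\sum_{y\in T_\omega^{-1}(x)}f(y)g_{\omega,0}(y)$ is a well-defined operator $\mathcal{B}_\omega\to\mathcal{B}_{\sigma\omega}$. $\mathcal{B}$ is the space of $f:\mathcal{J}_0\to\mathbb{R}$ with $f_\omega\in\mathcal{B}_\omega$ for each $\omega$, and $(\mathcal{L}_0f)_\omega=\mathcal{L}_{\sigma^{-1}\omega,0}f_{\sigma^{-1}\omega}$.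 For $\epsilon>0$, $H_\epsilon\subseteq\mathcal{J}_0$ is a measurable set (hole) with fibres $H_{\omega,\epsilon}\subseteq\mathcal{J}_{\omega,0}$; $\mathcal{J}_{\omega,\epsilon}=\mathcal{J}_{\omega,0}\setminus H_{\omega,\epsilon}$; $X_{\omega,N,\epsilon}=\{x\in\mathcal{J}_{\omega,0}:T_\omega^j(x)\notin H_{\sigma^j\omega,\epsilon},\ 0\le j\le N\}$; $X_{\omega,\infty,\epsilon}=\bigcap_{N\ge 0}X_{\omega,N,\epsilon}$; $\mathcal{L}_{\omega,\epsilon}(f)=\mathcal{L}_{\omega,0}(f\mathbf{1}_{\mathcal{J}_{\omega,\epsilon}})$. For operators, $A_\omega^n=A_{\sigma^{n-1}\omega}\circ\cdots\circ A_\omega$. The tuple $(\Omega,m,\sigma,\mathcal{J}_0,T,\mathcal{B},\mathcal{L}_0,\nu_0,\varphi_0,H_\epsilon)$ is a random open system if: (M1) $T:\mathcal{J}_0\to\mathcal{J}_0$ is measurable for $\mathscr{F}\otimes\mathscr{B}$; (M2) for every measurable $h\in\mathcal{B}$ the map $(\omega,x)\mapsto(\mathcal{L}_0h)_\omega(x)$ is measurable; (CCM) there are a random probability measure $\nu_0=\{\nu_{\omega,0}\}$ on $\mathcal{J}_0$ and measurable $\lambda_0:\Omega\to\mathbb{R}\setminus\{0\}$, $\varphi_0:\mathcal{J}_0\to(0,\infty)$ with $\mathcal{L}_{\omega,0}(\varphi_{\omega,0})=\lambda_{\omega,0}\varphi_{\sigma\omega,0}$ and $\nu_{\sigma\omega,0}(\mathcal{L}_{\omega,0}(f))=\lambda_{\omega,0}\nu_{\omega,0}(f)$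 for all $f\in\mathcal{B}_\omega$; the $\nu_{\omega,0}$ are non-atomic, $\lambda_{\omega,0}=\nu_{\sigma\omega,0}(\mathcal{L}_{\omega,0}\mathbf{1})$ and $\log\lambda_{\omega,0}\in L^1(m)$; $\mu_{\omega,0}(f):=\int f\varphi_{\omega,0}\,d\nu_{\omega,0}$ defines a ($T$-invariant) random probability measure $\mu_0$; (B) $\mathcal{B}_\omega\subseteq L^\infty(\nu_{\omega,0})$ and there is a measurable $m$-a.e. finite $K:\Omega\to[1,\infty)$ with $\|f\|_{\infty,\omega}\le K_\omega\|f\|_{\mathcal{B}_\omega}$, where $\|\cdot\|_{\infty,\omega}$ is the $L^\infty(\nu_{\omega,0})$ norm; (A) $H_{\epsilon'}\subseteq H_\epsilon$ for $0<\epsilon'\le\epsilon$; (X) for each sufficiently small $\epsilon>0$, $X_{\omega,\infty,\epsilon}\ne\emptyset$ for $m$-a.e. $\omega$. $\Omega_+=\{\omega:\mu_{\omega,0}(H_{\omega,\epsilon})>0\text{ for all }\epsilon>0\}$. For $\mu_{\omega,0}(H_{\omega,\epsilon})>0$ and $k\ge0$, $$\hat q^{(k)}_{\omega,\epsilon}=\frac{\mu_{\sigma^{-(k+1)}\omega,0}\Bigl(T^{-(k+1)}_{\sigma^{-(k+1)}\omega}(H_{\omega,\epsilon})\cap\bigcap_{j=1}^kT^{-(k+1)+j}_{\sigma^{-(k+1)}\omega}(H^c_{\sigma^{-j}\omega,\epsilon})\cap H_{\sigma^{-(k+1)}\omega,\epsilon}\Bigr)}{\mu_{\sigma^{-(k+1)}\omega,0}\bigl(T^{-(k+1)}_{\sigma^{-(k+1)}\omega}(H_{\omega,\epsilon})\bigr)}.$$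 Conditions: (C1) There is a measurable $m$-a.e. finite $C_1:\Omega\to\mathbb{R}_+$ with $\sup_{\epsilon\ge0}\|\mathcal{L}_{\omega,\epsilon}(f)\|_{\mathcal{B}_{\sigma\omega}}\le C_1(\omega)\|f\|_{\mathcal{B}_\omega}$. (C2) For each $\epsilon\ge0$ there are a random measure $\{\nu_{\omega,\epsilon}\}$ supported in $\mathcal{J}_0$ and measurable $\lambda_\epsilon:\Omega\to(0,\infty)$ with $\log\lambda_{\omega,\epsilon}\in L^1(m)$ and $\varphi_\epsilon:\mathcal{J}_0\to\mathbb{R}$ with $\mathcal{L}_{\omega,\epsilon}(\varphi_{\omega,\epsilon})=\lambda_{\omega,\epsilon}\varphi_{\sigma\omega,\epsilon}$, $\nu_{\sigma\omega,\epsilon}(\mathcal{L}_{\omega,\epsilon}(f))=\lambda_{\omega,\epsilon}\nu_{\omega,\epsilon}(f)$ for all $f\in\mathcal{B}_\omega$, and, $m$-a.e., $\nu_{\omega,0}(\varphi_{\omega,\epsilon})=1$, $\nu_{\omega,0}(\mathbf{1})=1$. (C3) There are operators $Q_{\omega,\epsilon}:\mathcal{B}_\omega\to\mathcal{B}_{\sigma\omega}$ such that, for $m$-a.e. $\omega$ and all $f\in\mathcal{B}_\omega$, $\lambda_{\omega,\epsilon}^{-1}\mathcal{L}_{\omega,\epsilon}(f)=\nu_{\omega,\epsilon}(f)\varphi_{\sigma\omega,\epsilon}+Q_{\omega,\epsilon}(f)$, $Q_{\omega,\epsilon}(\varphi_{\omega,\epsilon})=0$, $\nu_{\sigma\omega,\epsilon}(Q_{\omega,\epsilon}(f))=0$.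 (C4) For each $f\in\mathcal{B}$ there are measurable $C_f:\Omega\to(0,\infty)$ and $\alpha:\Omega\times\mathbb{N}\to(0,\infty)$ with $\alpha_\omega(N)\to0$ as $N\to\infty$ such that for $m$-a.e. $\omega$ and all $N$: $\sup_{\epsilon\ge0}\|Q^N_{\omega,\epsilon}f_\omega\|_{\infty,\sigma^N\omega}\le C_f(\omega)\alpha_\omega(N)\|f_\omega\|_{\mathcal{B}_\omega}$, $\sup_{\epsilon\ge0}\|Q^N_{\sigma^{-N}\omega,\epsilon}f_{\sigma^{-N}\omega}\|_{\infty,\omega}\le C_f(\omega)\alpha_\omega(N)\|f_{\sigma^{-N}\omega}\|_{\mathcal{B}_{\sigma^{-N}\omega}}$, and $\|\varphi_{\sigma^N\omega,0}\|_{\infty,\sigma^N\omega}\alpha_\omega(N)\to0$, $\|\varphi_{\sigma^{-N}\omega,0}\|_{\infty,\sigma^{-N}\omega}\alpha_\omega(N)\to0$. (C5) There is a measurable $m$-a.e. finite $C_2:\Omega\to[1,\infty)$ with $\sup_{\epsilon\ge0}\|\varphi_{\omega,\epsilon}\|_{\infty,\omega}\le C_2(\omega)$ and $\|\varphi_{\omega,0}\|_{\mathcal{B}_\omega}\le C_2(\omega)$. (C6) For $m$-a.e. $\omega$, $\lim_{\epsilon\to0}\nu_{\omega,0}(H_{\omega,\epsilon})=0$. (C7) There is a measurable $m$-a.e. finite $C_3:\Omega\to[1,\infty)$ such that for all sufficiently small $\epsilon>0$: $\inf\varphi_{\omega,0}\ge C_3^{-1}(\omega)>0$ and $\operatorname{ess\,inf}_\omega\inf\varphi_{\omega,\epsilon}\ge0$.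 (C8) For $m$-a.e. $\omega\in\Omega_+$ the limit $\hat q^{(k)}_{\omega,0}:=\lim_{\epsilon\to0}\hat q^{(k)}_{\omega,\epsilon}$ exists for each $k\ge0$. Escape rate: for a random probability measure $\zeta$, $\underline R_\epsilon(\zeta_\omega)=-\limsup_{N}\frac1N\log\zeta_\omega(X_{\omega,N,\epsilon})$ and $\overline R_\epsilon(\zeta_\omega)=-\liminf_{N}\frac1N\log\zeta_\omega(X_{\omega,N,\epsilon})$; if they coincide the common value is $R_\epsilon(\zeta_\omega)$.
   Formalization: Added: conformality of ν_{ω,0} under L_{ω,0} is also required for f·1_{X_{ω,N,ε}} with f in B_ω (without it the claim fails when B_ω is too small to determine ν_{ω,0}); ''ε sufficiently small'' is read with a threshold independent of ω. *)

(* Defs.v *)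
From HB Require Import structures.
From mathcomp Require Export all_boot all_order all_algebra.
From mathcomp Require Export all_classical all_reals all_analysis ess_sup_inf.
Export Order.TTheory GRing.Theory Num.Theory numFieldNormedType.Exports.

Set Implicit Arguments.
Unset Strict Implicit.
Unset Printing Implicit Defensive.

Local Open Scope classical_set_scope.
Local Open Scope ring_scope.

Notation borel X := (g_sigma_algebraType (@open X)).

(* A real-valued function on D : set X is represented by its extension by 0 to
   X.  B is a vector space of functions on D which N turns into a Banach space:
   (B, N) is an isometric copy of a Banach space. *)
Definition banach_function_space {R : realType} {X : Type}
    (D : set X) (B : set (X -> R)) (N : (X -> R) -> R) : Prop :=
  (forall f, B f -> forall x, ~ D x -> f x = 0) /\
  exists (V : completeNormedModType R) (ev : V -> X -> R),
    [/\ forall a u v, ev (a *: u + v) = (fun x => a * ev u x + ev v x),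
        injective ev, range ev = B & forall u, N (ev u) = `|u|].

(* unordered sum of a summable real family *)
Definition rsum {R : realType} {X : choiceType} (S : set X) (f : X -> R) : R :=
  fine (\esum_(y in S) ((EFin \o f)^\+ y)%E)
  - fine (\esum_(y in S) ((EFin \o f)^\- y)%E).

(* A_omega^n = A_(sigma^(n-1) omega) \o ... \o A_omega *)
Fixpoint cocycle {Om E : Type} (sigma : Om -> Om) (A : Om -> E -> E)
    (n : nat) (om : Om) (e : E) : E :=
  if n is k.+1 then A (iter k sigma om) (cocycle sigma A k om e) else e.

Definition nonatomic {d} {T : measurableType d} {R : realType}
    (mu : set T -> \bar R) : Prop :=
  forall A, measurable A -> (0 < mu A)%E ->
  exists B, [/\ measurable B, B `<=` A, (0 < mu B)%E & (mu B < mu A)%E].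

(* The objects making up a random open system.  sgi is the inverse of sg.  The
   values of T om outside J om are never used.  A random measure is a kernel
   (its family of fibre measures).  hole e is only used for e > 0. *)
Record system_data (R : realType) (dO : measure_display)
    (Om : measurableType dO) (X : completePseudoMetricType R) := SystemData {
  sg : Om -> Om;
  sgi : Om -> Om;
  J : Om -> set X;
  T : Om -> X -> X;
  B : Om -> set (X -> R);
  nB : Om -> (X -> R) -> R;
  g : Om -> X -> R;
  nu0 : R.-pker Om ~> borel X;
  lam0 : Om -> R;
  phi0 : Om -> X -> R;
  hole : R -> set (Om * borel X) }.

(* The data constrained by cond_C2 and cond_C3; only e >= 0 is used. *)
Record perturbation_data (R : realType) (dO : measure_display)
    (Om : measurableType dO) (X : completePseudoMetricType R) :=
  PerturbationData {
  nu : R -> R.-ker Om ~> borel X;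
  lam : R -> Om -> R;
  phi : R -> Om -> X -> R;
  Q : R -> Om -> (X -> R) -> X -> R }.

Section RandomOpenSystem.
Context {R : realType} {dO : measure_display} {Om : measurableType dO}
  {X : completePseudoMetricType R}.
Variables (m : probability Om R) (S : system_data Om X).

Local Notation sg := (sg S).
Local Notation sgi := (sgi S).
Local Notation J := (J S).
Local Notation B := (B S).
Local Notation nB := (nB S).
Local Notation nu0 := (nu0 S).
Local Notation lam0 := (lam0 S).
Local Notation phi0 := (phi0 S).
Local Notation hole := (hole S).

Definition J0 : set (Om * borel X) := [set p | J p.1 p.2].

Definition Tn (n : nat) (om : Om) : X -> X := cocycle sg (T S) n om.

Definition fibre (om : Om) (x : X) : set X := [set y | J om y /\ T S om y = x].

Definition L0 (om : Om) (f : X -> R) (x : X) : R :=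
  rsum (fibre om x) (fun y => f y * g S om y).

Definition L0_defined (om : Om) (f : X -> R) : Prop :=
  forall x, summable (fibre om x) (fun y => (f y * g S om y)%:E).

Definition H (e : R) (om : Om) : set X := [set x | hole e (om, x)].

(* the unperturbed system is the case e = 0 *)
Definition Je (e : R) (om : Om) : set X :=
  if 0 < e then J om `\` H e om else J om.

Definition Le (e : R) (om : Om) (f : X -> R) : X -> R :=
  L0 om (fun x => f x * \1_(Je e om) x).

Definition surv (e : R) (N : nat) (om : Om) : set X :=
  [set x | J om x /\
    forall j, (j <= N)%N -> ~ H e (iter j sg om) (Tn j om x)].

Definition surv_oo (e : R) (om : Om) : set X := \bigcap_N surv e N om.

Definition mu0 (om : Om) (A : set X) : \bar R :=
  (\int[nu0 om]_(x in A) (phi0 om x)%:E)%E.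

Definition supnorm (om : Om) (f : X -> R) : \bar R :=
  ('N[nu0 om]_+oo [(EFin \o f : borel X -> \bar R)])%E.

Record random_open_system : Prop := RandomOpenSystem {
  sgK : cancel sg sgi;
  sgiK : cancel sgi sg;
  measurable_sg : measurable_fun setT sg;
  measurable_sgi : measurable_fun setT sgi;
  sg_preserves : forall A, measurable A -> m (sg @^-1` A) = m A;
  sg_ergodic : forall A, measurable A -> sg @^-1` A = A -> m A = 0%E \/ m A = 1%E;
  X_hausdorff : hausdorff_space X;
  J_closed : forall om, closed (J om);
  (* [J om `&` ball x r !=set0] says that d(x, J om) < r: this is the
     measurability of om |-> d(x, J om).  When X is separable it implies that
     J0 is measurable. *)
  J_random : forall x r, 0 < r -> measurable [set om | J om `&` ball x r !=set0];
  J0_measurable : measurable J0;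
  T_J : forall om x, J om x -> J (sg om) (T S om x);
  B_banach : forall om, banach_function_space (J om) (B om) (nB om);
  g_B : forall om, B om (g S om);
  L0_wd : forall om f, B om f -> L0_defined om f /\ B (sg om) (L0 om f);
  hole_measurable : forall e, 0 < e -> measurable (hole e);
  hole_J0 : forall e, 0 < e -> hole e `<=` J0;
  Le_wd : forall e om f, 0 < e -> B om f -> B (sg om) (Le e om f);

  M1 : measurable_fun J0
    (fun p : Om * borel X => (sg p.1, T S p.1 p.2) : Om * borel X);
  M2 : forall h : Om -> X -> R, (forall om, B om (h om)) ->
    measurable_fun J0 (fun p : Om * borel X => h p.1 p.2) ->
    measurable_fun J0
      (fun p : Om * borel X => L0 (sgi p.1) (h (sgi p.1)) p.2);

  nu0_J : {ae m, forall om, nu0 om (~` J om) = 0%E};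
  lam0_measurable : measurable_fun setT lam0;
  lam0_neq0 : forall om, lam0 om != 0;
  phi0_B : forall om, B om (phi0 om);
  phi0_measurable : measurable_fun J0 (fun p : Om * borel X => phi0 p.1 p.2);
  phi0_gt0 : forall om x, J om x -> 0 < phi0 om x;
  L0_phi0 : forall om x, L0 om (phi0 om) x = lam0 om * phi0 (sg om) x;
  nu0_conformal : forall om f, B om f ->
    \int[nu0 (sg om)]_x L0 om f x = lam0 om * \int[nu0 om]_x f x;
  (* Conformality must also apply to the functions f \1_(surv e N om), which
     need not be in B om: L_(om,e)^n f = L_(om,0)^n (f \1_(surv e n.-1 om)).
     If B om is too small to determine nu0, the displayed identity alone does
     not relate L_(om,e) to the dynamics of T. *)
  nu0_conformal_surv : forall om f e N, 0 < e -> B om f ->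
    \int[nu0 (sg om)]_x L0 om (fun y => f y * \1_(surv e N om) y) x
    = lam0 om * \int[nu0 om]_x (f x * \1_(surv e N om) x);
  nu0_nonatomic : forall om, nonatomic (nu0 om);
  lam0_def : forall om, L0_defined om \1_(J om) /\
    (lam0 om)%:E = (\int[nu0 (sg om)]_x (L0 om \1_(J om) x)%:E)%E;
  log_lam0 : m.-integrable setT (EFin \o (fun om => ln (lam0 om)));
  mu0_probability : {ae m, forall om, mu0 om setT = 1%E};
  mu0_invariant : forall E : set (Om * borel X), measurable E ->
    (\int[m]_om mu0 om [set x | J om x /\ E (sg om, T S om x)]
     = \int[m]_om mu0 om [set x | E (om, x)])%E;

  axB : (forall om f, B om f -> f \in Lfun (nu0 om) +oo%E) /\
    exists K : Om -> R, [/\ measurable_fun setT K, forall om, 1 <= K om &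
      {ae m, forall om, forall f, B om f ->
        (supnorm om f <= (K om * nB om f)%:E)%E}];
  axA : forall e' e, 0 < e' -> e' <= e -> hole e' `<=` hole e;
  axX : \forall e \near 0^'+, {ae m, forall om, surv_oo e om !=set0} }.

Definition Omega_plus : set Om :=
  [set om | forall e, 0 < e -> (0 < mu0 om (H e om))%E].

Definition qhat (k : nat) (e : R) (om : Om) : R :=
  let om' := iter k.+1 sgi om in
  fine (mu0 om' [set x | [/\ J om' x, H e om (Tn k.+1 om' x),
      forall j, (1 <= j <= k)%N -> ~ H e (iter j sgi om) (Tn (k.+1 - j) om' x)
      & H e om' x]])
  / fine (mu0 om' [set x | J om' x /\ H e om (Tn k.+1 om' x)]).

Definition qhat0 (k : nat) (om : Om) : R := lim (qhat k e om @[e --> 0^'+]).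

Definition theta0 (om : Om) : R := 1 - limn (series (fun k => qhat0 k om)).

Variable P : perturbation_data Om X.
Local Notation nu := (nu P).
Local Notation lam := (lam P).
Local Notation phi := (phi P).
Local Notation Q := (Q P).

(* "m-a.e. finite" functions are taken to be finite everywhere, the inequality
   they control being required m-a.e. *)
Definition cond_C1 : Prop :=
  exists C1 : Om -> R, [/\ measurable_fun setT C1, forall om, 0 <= C1 om &
    {ae m, forall om, forall f, B om f -> forall e, 0 <= e ->
      nB (sg om) (Le e om f) <= C1 om * nB om f}].

Record cond_C2 : Prop := CondC2 {
  nu_at0 : forall om A, measurable A -> nu 0 om A = nu0 om A;
  lam_at0 : forall om, lam 0 om = lam0 om;
  phi_at0 : forall om x, phi 0 om x = phi0 om x;
  nu_J : forall e, 0 <= e -> {ae m, forall om, nu e om (~` J om) = 0%E};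
  nu_B : forall e, 0 <= e -> forall om f, B om f ->
    (nu e om).-integrable setT (EFin \o f);
  lam_measurable : forall e, 0 <= e -> measurable_fun setT (lam e);
  lam_gt0 : forall e, 0 <= e -> forall om, 0 < lam e om;
  log_lam : forall e, 0 <= e ->
    m.-integrable setT (EFin \o (fun om => ln (lam e om)));
  phi_B : forall e, 0 <= e -> forall om, B om (phi e om);
  phi_measurable : forall e, 0 <= e ->
    measurable_fun J0 (fun p : Om * borel X => phi e p.1 p.2);
  Le_phi : forall e, 0 <= e -> forall om x,
    Le e om (phi e om) x = lam e om * phi e (sg om) x;
  nu_Le : forall e, 0 <= e -> forall om f, B om f ->
    \int[nu e (sg om)]_x Le e om f x = lam e om * \int[nu e om]_x f x;
  nu0_phi : forall e, 0 <= e -> {ae m, forall om,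
    \int[nu0 om]_x phi e om x = 1 /\ \int[nu0 om]_x \1_(J om) x = 1 :> R} }.

Record cond_C3 : Prop := CondC3 {
  Q_B : forall e, 0 <= e -> forall om f, B om f -> B (sg om) (Q e om f);
  Q_linear : forall e, 0 <= e -> forall om a f h, B om f -> B om h ->
    Q e om (fun x => a * f x + h x) = (fun x => a * Q e om f x + Q e om h x);
  Q_decomposition : forall e, 0 <= e -> {ae m, forall om,
    [/\ forall f, B om f -> forall x, (lam e om)^-1 * Le e om f x
          = (\int[nu e om]_y f y) * phi e (sg om) x + Q e om f x,
        forall x, Q e om (phi e om) x = 0 &
        forall f, B om f -> \int[nu e (sg om)]_x Q e om f x = 0]} }.

Definition Qn (e : R) (N : nat) (om : Om) : (X -> R) -> X -> R :=
  cocycle sg (Q e) N om.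

Definition cond_C4 : Prop :=
  forall f : Om -> X -> R, (forall om, B om (f om)) ->
  exists (Cf : Om -> R) (alpha : Om -> nat -> R),
    [/\ measurable_fun setT Cf /\ (forall om, 0 < Cf om),
        (forall N, measurable_fun setT (alpha ^~ N)) /\
          (forall om N, 0 < alpha om N),
        forall om, alpha om N @[N --> \oo] --> (0 : R) &
    {ae m, forall om,
      [/\ forall N e, 0 <= e ->
            (supnorm (iter N sg om) (Qn e N om (f om))
             <= (Cf om * alpha om N * nB om (f om))%:E)%E,
          forall N e, 0 <= e -> let om' := iter N sgi om in
            (supnorm om (Qn e N om' (f om'))
             <= (Cf om * alpha om N * nB om' (f om'))%:E)%E,
          (supnorm (iter N sg om) (phi0 (iter N sg om)) * (alpha om N)%:E
             @[N --> \oo] --> 0)%E &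
          (supnorm (iter N sgi om) (phi0 (iter N sgi om)) * (alpha om N)%:E
             @[N --> \oo] --> 0)%E]}].

Definition cond_C5 : Prop :=
  exists C2 : Om -> R, [/\ measurable_fun setT C2, forall om, 1 <= C2 om &
    {ae m, forall om,
      (forall e, 0 <= e -> (supnorm om (phi e om) <= (C2 om)%:E)%E) /\
      nB om (phi0 om) <= C2 om}].

Definition cond_C6 : Prop :=
  {ae m, forall om, (nu0 om (H e om) @[e --> 0^'+] --> 0)%E}.

Definition cond_C7 : Prop :=
  exists C3 : Om -> R, [/\ measurable_fun setT C3, forall om, 1 <= C3 om,
    {ae m, forall om,
      (((C3 om)^-1)%:E <= ereal_inf [set (phi0 om x)%:E | x in J om])%E} &
    \forall e \near 0^'+,
      (0 <= ess_inf m
              (fun om => ereal_inf [set (phi e om x)%:E | x in J om]))%E].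

Definition cond_C8 : Prop :=
  {ae m, forall om, Omega_plus om -> forall k, cvg (qhat k e om @[e --> 0^'+])}.

Definition lower_rate (zeta : Om -> set X -> \bar R) (e : R) (om : Om) : \bar R :=
  (- limn_esup (fun N => (N%:R^-1)%:E * lne (zeta om (surv e N om))))%E.

Definition upper_rate (zeta : Om -> set X -> \bar R) (e : R) (om : Om) : \bar R :=
  (- limn_einf (fun N => (N%:R^-1)%:E * lne (zeta om (surv e N om))))%E.

Definition is_escape_rate zeta e om (r : R) : Prop :=
  lower_rate zeta e om = r%:E /\ upper_rate zeta e om = r%:E.

(* lim_(e -> 0) R_e(mu0 om) / mu0 om (H e om) = l; in particular the escape rate
   R_e(mu0 om) exists for all small e *)
Definition rate_ratio_cvg (om : Om) (l : R) : Prop :=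
  exists r : R -> R,
    (\forall e \near 0^'+, is_escape_rate mu0 e om (r e)) /\
    r e / fine (mu0 om (H e om)) @[e --> 0^'+] --> l.

End RandomOpenSystem.

(* Main.v *)
From HB Require Import structures.
From mathcomp Require Import measurable_realfun ring lra.
Require Import Defs.
Set Implicit Arguments.
Unset Strict Implicit.
Unset Printing Implicit Defensive.
Local Open Scope classical_set_scope.
Local Open Scope ring_scope.

(** Iterating (C3) along the orbit gives
      [L_e^n phi0 = lam_e^n (nu_e(phi0) phi_e + Q_e^n phi0)],
    while conformality of [nu0] turns the integrals of the left-hand side over
    everything and over the hole into [mu0]-masses of survivor sets.  Integrating
    over everything yields [nu_e(phi0) -> 1] and, with Birkhoff's theorem, the escape
    rate [int (ln lam0 - ln lam_e) dm].  Integrating over the hole, starting from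
    [sigma^(-n) omega], and splitting a hit of the hole according to the previous
    one yields
      [(lam0 - lam_e) / (lam0 mu0(H_e)) = 1 - sum_(k < n) qhat_k + error_n],
    where the error vanishes along the times [n] at which [sigma^(-n) omega] returns
    to a set where [C2] is bounded (Poincare recurrence).  Hence
    [(ln lam0 - ln lam_e) / mu0(H_e)] tends to [theta0] almost everywhere, and the
    integrals of these functions multiplied by [t + xi_e] converge by domination.

    The hypotheses at a given [e] only hold off a null set depending on [e], so
    every limit [e -> 0] is taken along sequences; this suffices since the escape
    rate does not depend on [omega] and is monotone in [e]. *)

(** * Integration *)

(** Two limits compete. The remainder [Q_e^n phi0] is small only for large [n], uniformly in [e],
    while survivor masses and eigenvalue products approach their unperturbed values only for fixed
    [n] as [e -> 0]. Hence the tolerance fixes [n] before the hole shrinks. The initial function is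
    [phi0] because its integrals against [nu0] are [mu0]-masses. Starting at [sigma^(-n) omega]
    keeps the hole, and so [mu0(H_e)] and [qhat_k], in the fixed fibre over [omega]. The price is
    the norm of [phi0] at [sigma^(-n) omega], whose bound (C5) need not stay bounded along the
    orbit. The remainder integrated over the hole is of order [nu0(H_e)]; the lower bound on [phi0]
    in (C7) makes it of order [mu0(H_e)], so it stays small after division by [mu0(H_e)]. In the
    last step the logarithmic drop is scaled by [kappa], which does not depend on [omega], so that
    its integral is [kappa] times the escape rate. Domination uses [phi_e >= 0] for the lower bound
    0, and [A] with [t + xi_e <= (1 + C) t] for the upper one. *)

Section ae_integral.
Context d (T : measurableType d) (R : realType) (mu : {measure set T -> \bar R}).
Local Open Scope ereal_scope.

(** The integral of a nonnegative function is a supremum over the simple functions below it, and a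
    larger function has more of them. *)
Lemma le_integral_ge0_nonmeasurable (f g : T -> \bar R) :
  (forall x, 0 <= f x) -> (forall x, f x <= g x) ->
  \int[mu]_x f x <= \int[mu]_x g x.
Proof.
move=> f0 fg; have g0 x : 0 <= g x by exact: le_trans (f0 x) (fg x).
rewrite !ge0_integralTE//; apply: ereal_sup_le => _ [h /= hf <-].
by exists h => // x; exact: le_trans (hf x) (fg x).
Qed.

(** [f] is squeezed between two measurable functions equal to [g] off a measurable null set [N]: on
    [N], [lo] is 0 and [up] is [+oo]. Both have the integral of [g]. *)
Let ae_eq_ge0_integral (f g : T -> \bar R) :
  (forall x, 0 <= f x) -> (forall x, 0 <= g x) ->
  measurable_fun setT g -> (\forall x \ae mu, f x = g x) ->
  \int[mu]_x f x = \int[mu]_x g x.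
Proof.
move=> f0 g0 mg [N [mN N0 fgN]].
have fg x : ~ N x -> f x = g x by apply: contra_notP => ?; exact: fgN.
pose up x := if x \in N then +oo else g x.
pose lo x := if x \in N then 0 else g x.
have mmem : measurable_fun setT (fun x => x \in N).
  apply: (measurable_fun_bool true); rewrite setTI.
  by rewrite (_ : _ @^-1` _ = N)//; apply/seteqP; split=> x /=;
    [move/set_mem|move/mem_set].
have mlo : measurable_fun setT lo.
  by apply: measurable_fun_ifT => //=; exact: mmem.
have mup : measurable_fun setT up.
  by apply: measurable_fun_ifT => //=; exact: mmem.
have lo0 x : 0 <= lo x by rewrite /lo; case: ifP.
have up0 x : 0 <= up x by rewrite /up; case: ifP.
have aeN h : (forall x, ~ N x -> h x = g x) -> \forall x \ae mu, setT x -> h x = g x.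
  move=> hg; exists N; split=> // x /= /not_implyP[_ hgx].
  by apply: contrapT => Nx; apply: hgx; exact: hg.
have -> : \int[mu]_x g x = \int[mu]_x lo x.
  apply/esym/ge0_ae_eq_integral => //; apply: aeN => x Nx.
  by rewrite /lo memNset.
apply/eqP; rewrite eq_le; apply/andP; split; last first.
  apply: le_integral_ge0_nonmeasurable => // x; rewrite /lo; case: ifPn => // /negP Nx.
  by rewrite fg// => ?; apply: Nx; rewrite inE.
have -> : \int[mu]_x lo x = \int[mu]_x up x.
  apply: ge0_ae_eq_integral => //; exists N; split=> // x /= /not_implyP[_].
  by rewrite /lo /up; case: ifPn => //; rewrite inE.
apply: le_integral_ge0_nonmeasurable => // x; rewrite /up; case: ifPn => // /negP Nx.
  by rewrite leey.
by rewrite fg// => ?; apply: Nx; rewrite inE.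
Qed.

Lemma ae_eq_integral_nonmeasurable (f g : T -> \bar R) :
  measurable_fun setT g -> (\forall x \ae mu, f x = g x) ->
  \int[mu]_x f x = \int[mu]_x g x.
Proof.
move=> mg fg; rewrite integralE [RHS]integralE; congr (_ - _);
  apply: ae_eq_ge0_integral => //.
- exact: measurable_funepos.
- by apply: filterS fg => x; rewrite !funeposE => ->.
- exact: measurable_funeneg.
- by apply: filterS fg => x; rewrite !funenegE => ->.
Qed.

Local Close Scope ereal_scope.

(* Needed because [theta0] is only almost everywhere equal to a measurable
   function. *)
Lemma ae_eq_Rintegral_nonmeasurable (f g : T -> R) :
  mu.-integrable setT (EFin \o g) -> {ae mu, forall x, f x = g x} ->
  \int[mu]_x f x = \int[mu]_x g x.
Proof.
move=> gi fg; congr fine; apply: ae_eq_integral_nonmeasurable.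
  by have /integrableP[] := gi.
by apply: filterS fg => x ->.
Qed.

Lemma Rintegral_dominated_convergence (f_ : (T -> R)^nat) (f g : T -> R) :
  (forall n, measurable_fun setT (f_ n)) -> measurable_fun setT f ->
  {ae mu, forall x, f_ n x @[n --> \oo] --> f x} ->
  mu.-integrable setT (EFin \o g) ->
  {ae mu, forall x, forall n, `|f_ n x| <= g x} ->
  mu.-integrable setT (EFin \o f) /\
  \int[mu]_x f_ n x @[n --> \oo] --> \int[mu]_x f x.
Proof.
move=> mf_ mf ff gi fg.
have [] := @dominated_convergence _ T R mu setT measurableT
  (fun n => EFin \o f_ n) (EFin \o f) (EFin \o g).
- by move=> n; exact/measurable_EFinP.
- exact/measurable_EFinP.
- by apply: filterS ff => x h _; apply: cvg_EFin => //; exact: nearW.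
- exact: gi.
- by apply: filterS fg => x h n _ /=; rewrite lee_fin.
move=> fi _ h; split=> //; move: h.
rewrite -[X in _ --> X](fineK (integrable_fin_num measurableT fi)).
by move=> /fine_cvgP[].
Qed.

End ae_integral.

(** * Essentially bounded functions on a probability space *)

Section Linfty.
Context d (T : measurableType d) (R : realType) (mu : {measure set T -> \bar R}).
Hypothesis mu1 : mu setT = 1%E.

Lemma ae_le_Lnorm_oo (f : T -> R) (c : R) :
  ('N[mu]_+oo [EFin \o f] <= c%:E)%E -> {ae mu, forall x, `|f x| <= c}.
Proof.
rewrite unlock mu1 lte01 => /ess_supP; apply: filterS => x /=.
by rewrite lee_fin.
Qed.

Lemma integrable_ae_le (f : T -> R) (c : R) : measurable_fun setT f ->
  {ae mu, forall x, `|f x| <= c} -> mu.-integrable setT (EFin \o f).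
Proof.
move=> mf fc; apply/integrableP; split; first exact/measurable_EFinP.
apply: (@le_lt_trans _ _ ((Num.max 0 c)%:E * mu setT)%E).
  apply: integral_le_bound => //; first exact/measurable_EFinP.
    by rewrite lee_fin le_max lexx.
  by apply: filterS fc => x h _ /=; rewrite lee_fin le_max h orbT.
by rewrite mu1 mule1 ltry.
Qed.

Lemma integrable_Lfun_oo (f : T -> R) : f \in Lfun mu +oo%E ->
  mu.-integrable setT (EFin \o f).
Proof.
rewrite inE => /andP[/[!inE]/= mf]; rewrite /finite_norm => fy.
have ffin : ('N[mu]_+oo[EFin \o f])%E \is a fin_num.
  by rewrite ge0_fin_numE// Lnorm_ge0.
apply: (integrable_ae_le (c := fine ('N[mu]_+oo[EFin \o f])%E)) => //.
by apply: ae_le_Lnorm_oo; rewrite fineK.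
Qed.

Lemma integrable_indicM (f : T -> R) (A : set T) : measurable A ->
  mu.-integrable setT (EFin \o f) ->
  mu.-integrable setT (EFin \o (fun x => f x * \1_A x)).
Proof.
move=> mA fi; apply: (le_integrable measurableT _ _ fi).
  apply/measurable_EFinP; apply: measurable_funM => //.
  by apply/measurable_EFinP; exact: measurable_int fi.
move=> x _ /=; rewrite lee_fin normrM ler_piMr// indicE.
by case: (_ \in _); rewrite ?normr0 ?normr1.
Qed.

Lemma Rintegral_indic (A : set T) : measurable A ->
  \int[mu]_x \1_A x = fine (mu A).
Proof. by move=> mA; rewrite /Rintegral integral_indic// setIT. Qed.

(** With [A] the hole, this makes error terms proportional to the [nu0]-mass of the hole. *)
Lemma normr_Rintegral_indicM_le (f : T -> R) (A : set T) (c : R) :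
  measurable A -> measurable_fun setT f -> 0 <= c ->
  {ae mu, forall x, `|f x| <= c} ->
  `|\int[mu]_x (f x * \1_A x)| <= c * fine (mu A).
Proof.
move=> mA mf c0 fc.
have fi := integrable_indicM mA (integrable_ae_le mf fc).
have muA : mu A \is a fin_num.
  rewrite ge0_fin_numE//; apply: (@le_lt_trans _ _ (mu setT)).
    by apply: le_measure; rewrite ?inE.
  by rewrite mu1 ltry.
rewrite -lee_fin EFin_normr_Rintegral// EFinM fineK//.
apply: le_trans (le_abse_integral _ _ _) _ => //.
  by have /integrableP[] := fi.
have -> : (\int[mu]_x `|(f x * \1_A x)%:E| = \int[mu]_(x in A) `|(f x)%:E|)%E.
  rewrite [RHS]integral_mkcond; apply: eq_integral => x _.
  rewrite patchE indicE; case: (_ \in _); rewrite ?mulr1 ?mulr0//=.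
  by rewrite normr0.
apply: integral_le_bound => //.
  by apply/measurable_EFinP; exact: measurable_funTS.
by apply: filterS fc => x h _; rewrite lee_fin.
Qed.

Lemma normr_Rintegral_le (f : T -> R) (c : R) : measurable_fun setT f -> 0 <= c ->
  {ae mu, forall x, `|f x| <= c} -> `|\int[mu]_x f x| <= c.
Proof.
move=> mf c0 fc; have := normr_Rintegral_indicM_le measurableT mf c0 fc.
rewrite mu1 mulr1; under eq_Rintegral do rewrite indicT mulr1.
by [].
Qed.

End Linfty.

(** * Measure-preserving maps *)

Section measure_preserving.
Context d (T : measurableType d) (R : realType) (m : probability T R).
Variable s : T -> T.
Hypothesis ms : measurable_fun setT s.
Hypothesis s_preserves : forall A, measurable A -> m (s @^-1` A) = m A.

Lemma measurable_preimage A : measurable A -> measurable (s @^-1` A).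
Proof. by move=> mA; rewrite -[_ @^-1` _]setTI; exact: ms. Qed.

Lemma measurable_fun_iter n : measurable_fun setT (iter n s).
Proof.
elim: n => [|n ih]; first exact: measurable_id.
exact: (measurableT_comp ms ih).
Qed.

Lemma ae_comp_preserving (P : T -> Prop) :
  {ae m, forall x, P x} -> {ae m, forall x, P (s x)}.
Proof.
move=> [N [mN N0 PN]]; exists (s @^-1` N); split.
- exact: measurable_preimage.
- by rewrite s_preserves.
- by move=> x /= Px; exact: PN.
Qed.

Lemma ae_iter_preserving (P : T -> Prop) :
  {ae m, forall x, P x} -> {ae m, forall x, forall n, P (iter n s x)}.
Proof.
move=> aeP; apply: ae_foralln => n.
elim: n P aeP => [//|n ih] P aeP; apply: filterS (ih _ (ae_comp_preserving aeP)).
by move=> x; rewrite /= -iterS.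
Qed.

Let s_mixin := isMeasurableFun.Build _ _ _ _ _ ms.
Let s_pack : {mfun _ >-> _} := HB.pack s s_mixin.

Let pushE : forall A, measurable A -> A `<=` setT -> pushforward m s_pack A = m A.
Proof. by move=> A mA _; rewrite /pushforward s_preserves. Qed.

Lemma ge0_integral_preserving (f : T -> \bar R) : (forall x, 0 <= f x)%E ->
  measurable_fun setT f -> (\int[m]_x f (s x) = \int[m]_x f x)%E.
Proof.
move=> f0 mf; rewrite -[RHS](eq_measure_integral m pushE).
by rewrite ge0_integral_pushforward// => x _; exact: f0.
Qed.

Lemma integrable_preserving (f : T -> R) : m.-integrable setT (EFin \o f) ->
  m.-integrable setT (EFin \o (f \o s)).
Proof.
move=> /integrableP[mf fi]; apply/integrableP; split.
  by rewrite (_ : _ \o _ = (EFin \o f) \o s)//; exact: measurableT_comp.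
by rewrite (ge0_integral_preserving (f := fun x => `|(f x)%:E|%E))//; exact: measurableT_comp.
Qed.

Lemma Rintegral_preserving (f : T -> R) : m.-integrable setT (EFin \o f) ->
  \int[m]_x f (s x) = \int[m]_x f x.
Proof.
move=> fi; congr fine; rewrite -[RHS](eq_measure_integral m pushE).
rewrite (@integral_pushforward _ _ _ _ _ _ ms _ setT (EFin \o f))//.
  by have /integrableP[] := fi.
exact: integrable_preserving.
Qed.

(** The sets [U N] of points visiting [E] at some time at least [N] decrease, and [U N.+1] is the
    preimage of [U N]. All have the same finite mass, so [U 0] minus [U N] is null, and [E] lies in
    [U 0]. *)
Lemma poincare_recurrence (E : set T) : measurable E ->
  {ae m, forall x, E x -> forall N, exists2 n, (N <= n)%N & E (iter n s x)}.
Proof.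
move=> mE; pose U N := \bigcup_(n in [set n | (N <= n)%N]) (iter n s @^-1` E).
have mU N : measurable (U N).
  apply: bigcup_measurable => n _; rewrite -[_ @^-1` _]setTI.
  exact: measurable_fun_iter.
have US N : U N.+1 = s @^-1` U N.
  apply/seteqP; split=> x /=.
    by move=> [[//|n] /= Nn Ex]; exists n => //=; rewrite -iterSr.
  by move=> [n /= Nn Ex]; exists n.+1 => //; rewrite /= -iterS iterSr.
have UE N : m (U N) = m (U 0%N).
  by elim: N => // N ih; rewrite US s_preserves.
have U0N N : m (U 0%N `\` U N) = 0%E.
  rewrite measureD//; last by rewrite ltey_eq fin_num_measure.
  rewrite setIidr; last by move=> x [n _ Ex]; exists n.
  apply: eq_trans (congr1 (fun z => m (U 0%N) - z)%E (UE N)) _.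
  by rewrite subee// fin_num_measure.
have /ae_foralln : forall N, {ae m, forall x, E x -> U N x}.
  move=> N; exists (U 0%N `\` U N); split=> //; first exact: measurableD.
  by move=> x /= /not_implyP[Ex nU]; split=> //; exists 0%N.
by apply: filterS => x EU Ex N; have [n] := EU N Ex; exists n.
Qed.

End measure_preserving.

(** * Birkhoff's ergodic theorem by maximal sums *)

Section birkhoff.
Context d (T : measurableType d) (R : realType) (m : probability T R).
Variable s : T -> T.
Hypothesis ms : measurable_fun setT s.
Hypothesis s_preserves : forall A, measurable A -> m (s @^-1` A) = m A.
Hypothesis s_ergodic :
  forall A, measurable A -> s @^-1` A = A -> m A = 0%E \/ m A = 1%E.

Definition birkhoff_sum (f : T -> R) n x := \sum_(i < n) f (iter i s x).

Lemma birkhoff_sumS f n x :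
  birkhoff_sum f n.+1 x = f x + birkhoff_sum f n (s x).
Proof.
rewrite /birkhoff_sum big_ord_recl/=; congr (_ + _).
by apply: eq_bigr => i _; rewrite /bump /= -iterS iterSr.
Qed.

(* [max_(k <= n) birkhoff_sum f k x], written as a recursion along the orbit. *)
Fixpoint birkhoff_max (f : T -> R) n x : R :=
  if n is k.+1 then Num.max 0 (f x + birkhoff_max f k (s x)) else 0.

Section bounded.
Variable f : T -> R.
Hypothesis fi : m.-integrable setT (EFin \o f).
Let M := birkhoff_max f.

Let M_ge0 n x : 0 <= M n x.
Proof. by case: n => //= n; rewrite le_max lexx. Qed.

Let M_nd n x : M n x <= M n.+1 x.
Proof.
elim: n x => [x|n ih x]; first exact: M_ge0.
by rewrite [leLHS]/= [leRHS]/= ge_max !le_max lexx/= lerD2l ih orbT.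
Qed.

Let M_ndW n k x : (n <= k)%N -> M n x <= M k x.
Proof.
by move=> nk; have /nondecreasing_seqP := fun n => M_nd n x; apply.
Qed.

Let sum_le_M n x : birkhoff_sum f n x <= M n x.
Proof.
elim: n x => [x|n ih x]; first by rewrite /birkhoff_sum big_ord0.
by rewrite birkhoff_sumS [leRHS]/= le_max lerD2l ih orbT.
Qed.

Let M_integrable n : m.-integrable setT (EFin \o M n).
Proof.
elim: n => [|n ih].
  by rewrite (_ : _ \o _ = cst 0%E)//; exact: integrable0.
have h := integrable_preserving ms s_preserves ih.
have := integrableD measurableT fi h.
apply: le_integrable => //.
  apply/measurable_EFinP; apply: measurable_maxr => //.
  apply: measurable_funD; apply/measurable_EFinP;
    [exact: measurable_int fi|exact: measurable_int h].
move=> x _; rewrite lee_fin /M/=.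
by case: (leP 0 (f x + _)) => // _; rewrite normr0.
Qed.

Let mM n : measurable_fun setT (M n).
Proof. by apply/measurable_EFinP; exact: measurable_int (M_integrable n). Qed.

Let unbounded := \bigcap_K \bigcup_n [set x | K%:R < M n x].

Let munbounded : measurable unbounded.
Proof.
apply: bigcapT_measurable => K; apply: bigcupT_measurable => n.
rewrite -[X in measurable X]setTI.
rewrite (_ : [set x | _] = M n @^-1` `]K%:R, +oo[%classic).
  exact: mM.
by apply/seteqP; split=> x /=; rewrite in_itv/= andbT.
Qed.

Let unbounded_gt x : unbounded x -> forall r, exists n, r < M n x.
Proof.
move=> Ux r; have [n _ /= h] := Ux (Num.truncn `|r|).+1 I.
exists n; apply: lt_trans h; apply: le_lt_trans (ler_norm r) _.
exact: truncnS_gt.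
Qed.

(** Shifting the starting point changes the maxima by the finite amount [f x]. The equality of sets
    is exact, as ergodicity is stated for strictly invariant sets. *)
Let unbounded_inv : s @^-1` unbounded = unbounded.
Proof.
apply/seteqP; split=> x /= Ux K _.
  have [n h] := unbounded_gt Ux (K%:R - f x); exists n.+1 => //=.
  by rewrite lt_max -ltrBlDl h orbT.
have [n h] := unbounded_gt Ux (Num.max 0 (K%:R + f x)); exists n => //=.
have := lt_le_trans h (M_nd n x); rewrite gt_max /M/= => /andP[].
by case: (leP 0 (f x + _)) => _; rewrite ?ltxx//; lra.
Qed.

(** By ergodicity the invariant set where the maxima [M n] are unbounded has mass 0 or 1. If it had
    mass 1, then [D n x = M n.+1 x - M n (s x) = max (- M n (s x)) (f x)] would tend to [f x] almost
    everywhere, dominated by [|f|]. Each [D n] has nonnegative integral, because [M n <= M n.+1] and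
    [s] preserves [m]; so [f] would have nonnegative integral. *)
Lemma birkhoff_sum_bounded : \int[m]_x f x < 0 ->
  {ae m, forall x, exists C : R, forall n, birkhoff_sum f n x <= C}.
Proof.
move=> f0; have [U0|U1] := s_ergodic munbounded unbounded_inv.
  exists unbounded; split=> // x /= h; apply: contrapT => nU; apply: h.
  move/existsNP : nU => [K /not_implyP[_ nK]]; exists K%:R => n.
  apply: le_trans (sum_le_M _ _) _; rewrite leNgt; apply/negP => h.
  by apply: nK; exists n.
exfalso; pose D n x := M n.+1 x - M n (s x).
have DE n x : D n x = Num.max (- M n (s x)) (f x).
  by rewrite /D /= addr_maxl sub0r addrK.
have Msi n := integrable_preserving ms s_preserves (M_integrable n).
have Di n : m.-integrable setT (EFin \o D n).
  by have := integrableB measurableT (M_integrable n.+1) (Msi n).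
have Dge0 n : 0 <= \int[m]_x D n x.
  rewrite RintegralB//; last exact: Msi.
  rewrite (Rintegral_preserving ms s_preserves (M_integrable n)) subr_ge0.
  by apply: le_Rintegral => // x _; exact: M_nd.
have [] := @Rintegral_dominated_convergence _ T R m D f (fun x => `|f x|).
- by move=> n; apply/measurable_EFinP; exact: measurable_int (Di n).
- by apply/measurable_EFinP; exact: measurable_int fi.
- exists (~` unbounded); split.
  + exact: measurableC.
  + apply: etrans (probability_setC m munbounded) _.
    by apply: etrans (congr1 (fun z => 1 - z)%E U1) _; rewrite subee.
  + move=> x /= h Ux; apply: h.
    have Usx : unbounded (s x) by rewrite -[_ _]/((s @^-1` unbounded) x) unbounded_inv.
    have [N hN] := unbounded_gt Usx (- f x).
    apply: cvg_near_cst; exists N => // n /= Nn.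
    rewrite DE; apply/max_idPr; rewrite lerNl ltW//.
    exact: lt_le_trans hN (M_ndW _ Nn).
- by have := integrable_abse fi.
- apply: aeW => x n; rewrite DE.
  have M0 := M_ge0 n (s x); have [fM|//] := leP (f x) (- M n (s x)).
  rewrite normrN ger0_norm// ler0_norm; lra.
move=> _ h.
move: f0; rewrite ltNge => /negP; apply.
rewrite -(cvg_lim _ h)//; apply: limr_ge; first by apply/cvg_ex; eexists; exact: h.
by apply: nearW => n; exact: Dge0.
Qed.

End bounded.

Let birkhoff_sumB f (c : R) n x :
  birkhoff_sum (fun y => f y - c) n x = birkhoff_sum f n x - n%:R * c.
Proof.
by rewrite /birkhoff_sum sumrB sumr_const card_ord mulr_natl.
Qed.

Let integrableBcst f (c : R) : m.-integrable setT (EFin \o f) ->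
  m.-integrable setT (EFin \o (fun x => f x - c)).
Proof.
move=> fi; have ci := finite_measure_integrable_cst m c measurableT.
by have := integrableB measurableT fi ci.
Qed.

Let RintegralBcst f (c : R) : m.-integrable setT (EFin \o f) ->
  \int[m]_x (f x - c) = \int[m]_x f x - c.
Proof.
move=> fi; rewrite RintegralB//; last exact: finite_measure_integrable_cst.
rewrite Rintegral_cst// -[in RHS](mulr1 c); congr (_ - _ * _).
exact: (congr1 fine (probability_setT m)).
Qed.

(** Subtracting slightly more than the mean makes the integral negative, so the sums of the
    difference are bounded by some [C], and [C / n] is at most [e / 2] once [n] exceeds
    [2 * |C| / e]. The excess runs through the countably many [1 / k.+1] to obtain a single null
    set. *)
Let birkhoff_upper f : m.-integrable setT (EFin \o f) ->
  {ae m, forall x, forall e : R, 0 < e -> \forall n \near \oo,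
    n%:R^-1 * birkhoff_sum f n x <= \int[m]_x f x + e}.
Proof.
move=> fi; pose I := \int[m]_x f x.
have /ae_foralln : forall k : nat, {ae m, forall x, exists C : R, forall n,
    birkhoff_sum f n x - n%:R * (I + k.+1%:R^-1) <= C}.
  move=> k.
  have := birkhoff_sum_bounded (integrableBcst (I + k.+1%:R^-1) fi).
  rewrite RintegralBcst// -/I.
  have -> : I - (I + k.+1%:R^-1) < 0 by rewrite opprD addrA subrr sub0r oppr_lt0.
  move=> /(_ isT); apply: filterS => x [C hC]; exists C => n.
  by rewrite -birkhoff_sumB.
apply: filterS => x hx e e0.
have e20 : 0 < e / 2 by rewrite divr_gt0.
have [k _ hk] := near_infty_natSinv_lt (PosNum e20).
have {}hk : k.+1%:R^-1 < e / 2 by exact: (hk k (leqnn k)).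
have [C hC] := hx k.
have := nbhs_infty_gtr (2 * `|C| / e); apply: filterS2 (nbhs_infty_gt 0%N) => n n0 nC.
have n0' : 0 < n%:R :> R by rewrite ltr0n.
rewrite mulrC ler_pdivrMr//.
have h := hC n; have hCn := ler_norm C.
move: nC; rewrite ltr_pdivrMr// => nC.
have : n%:R * k.+1%:R^-1 <= n%:R * (e / 2) by rewrite ler_pM2l// ltW.
rewrite -/I; move: h hCn nC; rewrite mulrDr mulrDl.
by move: (k.+1%:R^-1) (n%:R : R) (birkhoff_sum _ _ _) => u v w; lra.
Qed.

Theorem birkhoff_ergodic f : m.-integrable setT (EFin \o f) ->
  {ae m, forall x,
    n%:R^-1 * birkhoff_sum f n x @[n --> \oo] --> \int[m]_x f x}.
Proof.
move=> fi.
have fNi : m.-integrable setT (EFin \o (fun x => - f x)).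
  by have := integrableN fi.
apply: filterS2 (birkhoff_upper fi) (birkhoff_upper fNi) => x up lo.
have fN : \int[m]_x (- f x) = - \int[m]_x f x.
  by rewrite -mulN1r -RintegralZl//; apply: eq_Rintegral => y _; rewrite mulN1r.
apply/cvgrPdist_le => e e0.
apply: filterS2 (up e e0) (lo e e0) => n h1 h2.
move: h2; rewrite fN (_ : birkhoff_sum _ n x = - birkhoff_sum f n x); last first.
  by rewrite /birkhoff_sum sumrN.
by rewrite mulrN ler_norml => h2; lra.
Qed.

End birkhoff.

(** * Real sequences and monotone functions *)

(* [u] enumerates the rationals and the jumps of [r], of which there is at most
   one for each rational lying in the gap. *)
Lemma nondecreasing_determined_by_sequence (R : realType) (r : R -> R) (b : R) :
  (forall x y : R, 0 < x -> x <= y -> y < b -> r x <= r y) ->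
  exists u : nat -> R, forall F : R -> \bar R,
    (forall x y : R, 0 < x -> x <= y -> y < b -> (F x <= F y)%E) ->
    (forall n, 0 < u n < b -> F (u n) = (r (u n))%:E) ->
    forall x : R, 0 < x < b -> F x = (r x)%:E.
Proof.
move=> ndr.
pose jump (q : rat) (x : R) := [/\ 0 < x < b,
  forall y : R, 0 < y < x -> r y < ratr q & forall y, x < y < b -> ratr q < r y].
have jump_uniq q x y : jump q x -> jump q y -> x = y.
  wlog xy : x y / x < y => [wlg jx jy|].
    by have [xy|yx|//] := ltgtP x y; [exact: wlg|exact/esym/wlg].
  move=> [/andP[x0 _] _ hx] [/andP[_ yb] hy _].
  have [z /andP[xz zy]] : exists z, x < z < y by exists ((x + y) / 2); rewrite !midf_lt.
  have := hx z; rewrite xz (lt_trans zy yb) => /(_ isT).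
  have := hy z; rewrite zy (lt_trans x0 xz) => /(_ isT) h /(lt_trans h).
  by rewrite ltxx.
(* Codes of nothing, and rationals lying in no gap, yield 0, which is outside the range
   [0 < u n < b]. *)
pose u n := match unpickle n : option (rat + rat) with
  | Some (inl q) => ratr q
  | Some (inr q) => xget 0 [set x | jump q x]
  | None => 0 end.
exists u => F ndF Fu x /andP[x0 xb].
have Frat q : 0 < (ratr q : R) < b -> F (ratr q) = (r (ratr q))%:E.
  by have := Fu (pickle (inl q : rat + rat)); rewrite /u pickleK; apply.
have [[q jq]|nj] := pselect (exists q, jump q x).
  have ux : u (pickle (inr q : rat + rat)) = x.
    by rewrite /u pickleK; apply: xget_unique => // y /jump_uniq/(_ jq).
  by have := Fu (pickle (inr q : rat + rat)); rewrite ux x0 xb; apply.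
have Fge y : 0 < y < x -> ((r y)%:E <= F x)%E.
  move=> /andP[y0 yx]; have [q /itvP qi] := rat_in_itvoo yx.
  have qb : ratr q < b by apply: lt_trans xb; rewrite qi.
  apply: (@le_trans _ _ (F (ratr q))); last by apply: ndF; rewrite ?qi// (lt_trans y0)// qi.
  rewrite Frat; last by rewrite qb (lt_trans y0)// qi.
  by rewrite lee_fin ndr// qi.
have Fle y : x < y < b -> (F x <= (r y)%:E)%E.
  move=> /andP[xy yb]; have [q /itvP qi] := rat_in_itvoo xy.
  have qb : ratr q < b by apply: lt_trans yb; rewrite qi.
  apply: (@le_trans _ _ (F (ratr q))); first by apply: ndF; rewrite ?qi.
  rewrite Frat; last by rewrite qb (lt_trans x0)// qi.
  by rewrite lee_fin ndr// ?qi// (lt_trans x0)// qi.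
(* Since [x] is not a jump, no rational separates the values of [r] on the left of [x] from those on
   the right. [F x] and [r x] both lie between these values, so they coincide. *)
have sandwich (c d : R) : (forall y, 0 < y < x -> r y <= c) ->
    (forall y, x < y < b -> d <= r y) -> d <= c.
  move=> hc hd; rewrite leNgt; apply/negP => cd.
  have [q /itvP qi] := rat_in_itvoo cd.
  apply: nj; exists q; split=> [|y yx|y xy]; first by rewrite x0.
    by rewrite (le_lt_trans (hc _ yx))// qi.
  by rewrite (lt_le_trans _ (hd _ xy))// qi.
have rge y : 0 < y < x -> r y <= r x by move=> /andP[y0 yx]; rewrite ndr// ltW.
have rle y : x < y < b -> r x <= r y by move=> /andP[xy yb]; rewrite ndr// ltW.
have Ffin : F x \is a fin_num.
  have hx : 0 < x / 2 < x by lra.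
  have hb : x < (x + b) / 2 < b by rewrite !midf_lt.
  rewrite fin_numE; apply/andP; split; apply/eqP => E.
    by have := Fge _ hx; rewrite E leeNy_eq.
  by have := Fle _ hb; rewrite E leye_eq.
rewrite -(fineK Ffin); congr EFin; apply/eqP; rewrite eq_le; apply/andP; split.
  by apply: sandwich => // y yx; rewrite -lee_fin fineK// Fle.
by apply: sandwich => // y yx; rewrite -lee_fin fineK// Fge.
Qed.

Lemma cvg0_le_norm (R : realType) (f g : nat -> R) :
  g k @[k --> \oo] --> (0 : R) -> (forall k, `|f k| <= g k) ->
  f k @[k --> \oo] --> (0 : R).
Proof.
move=> g0 fg; apply/cvgrPdist_le => e e0.
move/cvgrPdist_le : g0 => /(_ e e0); apply: filterS => k; rewrite !sub0r !normrN => h.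
exact: le_trans (fg k) (le_trans (ler_norm _) h).
Qed.

Lemma cvg_sum_ord (R : realType) (f : nat -> nat -> R) (l : nat -> R) (N : nat) :
  (forall j, f j k @[k --> \oo] --> l j) ->
  \sum_(j < N) f j k @[k --> \oo] --> \sum_(j < N) l j.
Proof.
move=> fl; elim: N => [|N ih].
  by rewrite big_ord0; under eq_fun do rewrite big_ord0; exact: cvg_cst.
by rewrite big_ord_recr; under eq_fun do rewrite big_ord_recr/=; exact: cvgD.
Qed.

(** Handles the exchange of limits: the tolerance [e] fixes the number of iterates, hence the
    approximating sequence [a], and only then does [k] tend to infinity. *)
Lemma cvg_approx (R : realType) (c : nat -> R) (l : R) :
  (forall e : R, 0 < e -> exists (a : nat -> R) (la : R),
    [/\ a k @[k --> \oo] --> la, `|l - la| <= e & forall k, `|a k - c k| <= e]) ->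
  c k @[k --> \oo] --> l.
Proof.
move=> h; apply/cvgrPdist_le => e e0.
have e30 : 0 < e / 3 by rewrite divr_gt0.
have [a [la [al lla ac]]] := h _ e30.
move/cvgrPdist_le : al => /(_ _ e30); apply: filterS => k hk.
rewrite (_ : l - c k = (l - la) + ((la - a k) + (a k - c k))); last by ring.
apply: le_trans (ler_normD _ _) _; apply: le_trans (lerD lla (ler_normD _ _)) _.
have := ac k; lra.
Qed.

Lemma cvgn_ge (R : realType) (v : nat -> R) (l c : R) :
  v k @[k --> \oo] --> l -> (forall k, c <= v k) -> c <= l.
Proof.
move=> vl cv; rewrite -(cvg_lim _ vl)//; apply: limr_ge; last exact: nearW.
by apply/cvg_ex; exists l.
Qed.

Lemma cvgn_le (R : realType) (v : nat -> R) (l c : R) :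
  v k @[k --> \oo] --> l -> (forall k, v k <= c) -> l <= c.
Proof.
move=> vl cv; rewrite -(cvg_lim _ vl)//; apply: limr_le; last exact: nearW.
by apply/cvg_ex; exists l.
Qed.

Lemma near_lt_at_right (R : realType) (c : R) :
  0 < c -> \forall e \near 0^'+, 0 < e < c.
Proof.
move=> c0; near=> e; apply/andP; split; near: e;
  [exact: nbhs_right_gt|exact: nbhs_right_lt].
Unshelve. all: by end_near. Qed.

Lemma le_limn_esup (R : realType) (v w : nat -> \bar R) :
  (forall n, v n <= w n)%E -> (limn_esup v <= limn_esup w)%E.
Proof.
move=> vw; rewrite !limn_esup_lim; apply: lee_lim.
- exact: is_cvg_esups.
- exact: is_cvg_esups.
apply: nearW => n; apply: ge_ereal_sup => _ [k /= nk <-].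
by apply: le_trans (vw k) _; apply: ereal_sup_ubound; exists k.
Qed.

Lemma le_limn_einf (R : realType) (v w : nat -> \bar R) :
  (forall n, v n <= w n)%E -> (limn_einf v <= limn_einf w)%E.
Proof.
move=> vw; rewrite -[v](_ : (fun n => - - v n)%E = v); last first.
  by apply/funext => n; rewrite oppeK.
rewrite -[w](_ : (fun n => - - w n)%E = w); last by apply/funext => n; rewrite oppeK.
rewrite !(limn_einfN (fun n => - _ n)%E) leeN2; apply: le_limn_esup => n.
by rewrite leeN2.
Qed.

(** [f] vanishes almost everywhere, and [h] with it. Applied to [phi0] and [phi e] under the measure
    [nu e]. *)
Lemma Rintegral_eq0_vanish d (T : measurableType d) (R : realType)
    (mu : {measure set T -> \bar R}) (f h : T -> R) :
  mu.-integrable setT (EFin \o f) -> (forall x, 0 <= f x) ->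
  measurable_fun setT h -> (forall x, f x = 0 -> h x = 0) ->
  \int[mu]_x f x = 0 -> \int[mu]_x h x = 0.
Proof.
move=> fi f0 mh fh If0.
have : (\int[mu]_x `|(f x)%:E| = 0)%E.
  under eq_integral do rewrite gee0_abs ?lee_fin//.
  by rewrite -(fineK (integrable_fin_num measurableT fi)) [fine _]If0.
have mf : measurable_fun setT (EFin \o f) by have /integrableP[] := fi.
move=> /(ae_eq_integral_abs mu measurableT mf) ae0.
rewrite /Rintegral (ae_eq_integral (cst 0%E))//.
- by rewrite integral0.
- exact/measurable_EFinP.
- by apply: filterS ae0 => x /[apply] -[] /fh ->.
Qed.

(** * Random open systems *)

Section rsum.
Context (R : realType) (X : choiceType).
Implicit Types (D : set X) (f h : X -> R).

Lemma eq_rsum D f h : (forall y, D y -> f y = h y) -> rsum D f = rsum D h.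
Proof.
by move=> fh; rewrite /rsum; congr (fine _ - fine _); apply: eq_esum => y Dy;
  rewrite ?funeposE ?funenegE /= fh.
Qed.

(** The factors 0 and 1, the only values of an indicator, commute with [rsum] for arbitrary
    families, so the indicator of a survivor set can be moved through [L0]. *)
Lemma rsumZ_bool D (b : bool) f : rsum D (fun y => b%:R * f y) = b%:R * rsum D f.
Proof.
case: b; first by rewrite mul1r; apply: eq_rsum => y _; rewrite mul1r.
rewrite mul0r /rsum !esum1 ?subrr// => y _;
  by rewrite ?funeposE ?funenegE /= mul0r ?oppe0 ?oppr0 maxEle lexx.
Qed.

End rsum.

Section open_system.
Context {R : realType} {dO : measure_display} {Om : measurableType dO}
  {X : completePseudoMetricType R}.
Variables (m : probability Om R) (S : system_data Om X).
Implicit Types (e : R) (om : Om) (f h : X -> R).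
Hypothesis hS : random_open_system m S.

Local Notation sg := (sg S).
Local Notation sgi := (sgi S).
Local Notation J := (J S).
Local Notation B := (B S).
Local Notation nB := (nB S).
Local Notation nu0 := (nu0 S).
Local Notation lam0 := (lam0 S).
Local Notation phi0 := (phi0 S).
Local Notation hole := (hole S).
Local Notation H := (H S).
Local Notation Tn := (Tn S).
Local Notation surv := (surv S).
Local Notation mu0 := (mu0 S).
Local Notation Le := (Le S).
Local Notation L0 := (L0 S).

Lemma Tn_shift n om x : Tn n.+1 om x = Tn n (sg om) (T S om x).
Proof.
rewrite /Tn; elim: n => [//|n ih].
by rewrite [RHS]/= -iterSr -ih.
Qed.

Lemma Tn_J n om x : J om x -> J (iter n sg om) (Tn n om x).
Proof. by move=> Jx; elim: n => //= n ih; exact: (T_J hS). Qed.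

Lemma Tn_add n k om x : Tn (n + k) om x = Tn n (iter k sg om) (Tn k om x).
Proof.
elim: n => [//|n ih]; rewrite addSn /Tn /= -!/(Tn _ _ _) ih.
by rewrite iterD.
Qed.

Lemma survS e N om x : surv e N.+1 om x <->
  surv e 0 om x /\ surv e N (sg om) (T S om x).
Proof.
split=> [[Jx sx]|[[Jx s0] [_ sx]]].
  split; first by split=> // j; rewrite leqn0 => /eqP ->; exact: (sx 0%N).
  split; first exact: (T_J hS).
  by move=> j jN; rewrite -iterSr -Tn_shift; exact: sx.
split=> // -[_|j jN]; first exact: (s0 0%N).
by rewrite Tn_shift iterSr; exact: sx.
Qed.

Lemma surv0E e om : 0 < e -> surv e 0 om = Je S e om.
Proof.
move=> e0; rewrite /Je e0; apply/seteqP; split=> x [Jx h]; split=> //.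
  exact: (h 0%N).
by move=> j; rewrite leqn0 => /eqP ->.
Qed.

Lemma surv_last e N om x : surv e N.+1 om x <->
  surv e N om x /\ ~ H e (iter N.+1 sg om) (Tn N.+1 om x).
Proof.
split=> [[Jx h]|[[Jx h] hN]]; split=> //.
- by split=> // j jN; apply: h; exact: leqW.
- exact: h.
- by move=> j; rewrite leq_eqVlt => /predU1P[->//|]; exact: h.
Qed.

Lemma surv_antitone e e' N om : 0 < e' -> e' <= e ->
  surv e N om `<=` surv e' N om.
Proof.
move=> e'0 ee' x [Jx h]; split=> // j jN Hx; apply: (h j jN).
exact: (axA hS e'0 ee').
Qed.

Lemma B_out om f x : B om f -> ~ J om x -> f x = 0.
Proof. by move=> Bf; have [h _] := B_banach hS om; exact: h. Qed.

Lemma B_scale om a f : B om f -> B om (fun x => a * f x).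
Proof.
have [_ [V [ev [evL _ evB _]]]] := B_banach hS om.
rewrite -evB => -[u _ <-].
have ev0 : ev 0 = fun=> 0.
  apply/funext => x; have := evL (-1) 0 0; rewrite scaler0 addr0 => /(congr1 (@^~ x)).
  by lra.
by exists (a *: u + 0) => //; rewrite evL ev0; apply/funext => x; rewrite addr0.
Qed.

Lemma B_add om f h : B om f -> B om h -> B om (fun x => f x + h x).
Proof.
have [_ [V [ev [evL _ evB _]]]] := B_banach hS om.
rewrite -evB => -[u _ <-] [v _ <-].
by exists (1 *: u + v) => //; rewrite evL; apply/funext => x; rewrite mul1r.
Qed.

Lemma nB_ge0 om f : B om f -> 0 <= nB om f.
Proof.
have [_ [V [ev [_ _ evB nE]]]] := B_banach hS om.
by rewrite -evB => -[u _ <-]; rewrite nE.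
Qed.

Lemma nu0_setT om : nu0 om setT = 1%E.
Proof. exact: prob_kernel. Qed.

Lemma B_integrable om f : B om f ->
  (nu0 om).-integrable setT (EFin \o (f : borel X -> R)).
Proof.
by move=> Bf; apply: integrable_Lfun_oo (nu0_setT om) _ _; exact: (axB hS).1.
Qed.

Lemma B_measurable om f : B om f -> measurable_fun setT (f : borel X -> R).
Proof. by move=> /B_integrable/measurable_int/measurable_EFinP. Qed.

(* Conformality is only available for [f \1_(surv e N om)], not for arbitrary
   bounded measurable functions. *)
Lemma L0_indic_surv e N om f x : 0 < e ->
  L0 om (fun y => f y * \1_(surv e N.+1 om) y) x
  = Le e om f x * \1_(surv e N (sg om)) x.
Proof.
move=> e0; rewrite mulrC indicE /Le {2}/L0 -rsumZ_bool; apply: eq_rsum => y [Jy Ty].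
rewrite -surv0E// !indicE.
have -> : (y \in surv e N.+1 om) = (x \in surv e N (sg om)) && (y \in surv e 0 om).
  apply/idP/andP => [|[]]; rewrite !inE -Ty; first by move/survS => [].
  by move=> s1 s0; apply/survS.
by rewrite -mulnb natrM; ring.
Qed.

(** * Iterated open transfer operators and survivor sets *)

Definition Ln e n om f := cocycle sg (Le e) n om f.

Lemma Ln_B e n om f : 0 < e -> B om f -> B (iter n sg om) (Ln e n om f).
Proof. by move=> e0 Bf; elim: n => //= n ih; exact: (Le_wd hS). Qed.

Definition prod_iter (l : Om -> R) n om := \prod_(i < n) l (iter i sg om).

Lemma prod_iterS l n om : prod_iter l n.+1 om = prod_iter l n om * l (iter n sg om).
Proof. by rewrite /prod_iter big_ord_recr. Qed.

(** By [L0_indic_surv] the outermost [Le] and the indicator of [surv e N] merge into [L0] of a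
    function cut off by [surv e N.+1], to which conformality applies. Each operator removed thus
    adds one to [N]. *)
Lemma Rintegral_Ln_surv e n N om f : 0 < e -> B om f ->
  \int[nu0 (iter n sg om)]_x (Ln e n om f x * \1_(surv e N (iter n sg om)) x)
  = prod_iter lam0 n om * \int[nu0 om]_x (f x * \1_(surv e (n + N) om) x).
Proof.
move=> e0 Bf; elim: n N => [|n ih] N; first by rewrite /prod_iter big_ord0 mul1r.
rewrite prod_iterS addSnnS -mulrA mulrCA -ih.
rewrite -(nu0_conformal_surv hS); [|by []|exact: Ln_B].
by apply: eq_Rintegral => x _; rewrite L0_indic_surv.
Qed.

(** The [n.+1] operators test the hole at times 0 to [n] only, whence [surv e n]: the outermost [Le]
    is [L0] after multiplication by the indicator of [surv e 0]. *)
Lemma Rintegral_Ln e n om f : 0 < e -> B om f ->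
  \int[nu0 (iter n.+1 sg om)]_x Ln e n.+1 om f x
  = prod_iter lam0 n.+1 om * \int[nu0 om]_x (f x * \1_(surv e n om) x).
Proof.
move=> e0 Bf; rewrite prod_iterS -mulrA mulrCA -[in surv e n om](addn0 n).
rewrite -(Rintegral_Ln_surv n 0 e0 Bf) -(nu0_conformal_surv hS); [|by []|exact: Ln_B].
by apply: eq_Rintegral => x _; rewrite /= /Le surv0E.
Qed.

(** * Measurability in the product space *)

Lemma measurable_section (E : set (Om * borel X)) om : measurable E ->
  measurable ([set x | E (om, x)] : set (borel X)).
Proof.
move=> mE; rewrite (_ : [set x | _] = xsection E om); first exact: measurable_xsection.
by rewrite /xsection; apply/seteqP; split=> x /=; rewrite inE.
Qed.

(** Cut down to [J0] because [T S om] is meaningful only on [J om]; (M1) gives measurability of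
    exactly this set. *)
Definition skew_preimage (E : set (Om * borel X)) : set (Om * borel X) :=
  [set p | J p.1 p.2 /\ E (sg p.1, T S p.1 p.2)].

Lemma measurable_skew_preimage E : measurable E -> measurable (skew_preimage E).
Proof. by move=> mE; have := M1 hS (J0_measurable hS) mE. Qed.

Definition skew_preimage_iter n (E : set (Om * borel X)) : set (Om * borel X) :=
  [set p | J p.1 p.2 /\ E (iter n sg p.1, Tn n p.1 p.2)].

Lemma skew_preimage_iterS n E :
  skew_preimage_iter n.+1 E = skew_preimage (skew_preimage_iter n E).
Proof.
apply/seteqP; split=> -[om x] [/= Jx Ex].
  by split=> //=; split; [exact: (T_J hS)|rewrite /= -iterSr -Tn_shift].
by split=> //=; move: Ex => [_]; rewrite /= -iterSr -Tn_shift.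
Qed.

Lemma measurable_skew_preimage_iter n E : measurable E ->
  measurable (skew_preimage_iter n E).
Proof.
move=> mE; elim: n => [|n ih]; last first.
  by rewrite skew_preimage_iterS; exact: measurable_skew_preimage.
rewrite (_ : skew_preimage_iter 0 E = J0 S `&` E).
  exact: measurableI (J0_measurable hS) mE.
by apply/seteqP; split=> -[om x].
Qed.

Lemma measurable_surv_set e N : 0 < e ->
  measurable ([set p | surv e N p.1 p.2] : set (Om * borel X)).
Proof.
move=> e0; rewrite (_ : [set p | _] = J0 S `&`
    \bigcap_(j in `I_N.+1) (J0 S `\` skew_preimage_iter j (hole e))).
  apply: measurableI; first exact: (J0_measurable hS).
  apply: bigcap_measurable => [|j _]; first by exists 0%N.
  apply: measurableD; first exact: (J0_measurable hS).
  exact: measurable_skew_preimage_iter (hole_measurable hS e0).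
apply/seteqP; split=> -[om x] /= [Jx h]; split=> // j /= jN.
  by split=> // -[_]; exact: h.
by move=> Hx; have [_] := h j jN; apply.
Qed.

Lemma measurable_J om : measurable (J om : set (borel X)).
Proof. exact: measurable_section om (J0_measurable hS). Qed.

Lemma measurable_H e om : 0 < e -> measurable (H e om : set (borel X)).
Proof. by move=> e0; exact: measurable_section om (hole_measurable hS e0). Qed.

Lemma measurable_surv e N om : 0 < e -> measurable (surv e N om : set (borel X)).
Proof. by move=> e0; exact: measurable_section om (measurable_surv_set N e0). Qed.

(** * The fibre measures [mu0] and their invariance *)

Lemma phi0_ge0 om x : 0 <= phi0 om x.
Proof.
have [Jx|nJx] := pselect (J om x); first exact/ltW/(phi0_gt0 hS).
by rewrite (B_out (phi0_B hS om)).
Qed.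

Lemma mu0E om (A : set (borel X)) : measurable A ->
  mu0 om A = (\int[nu0 om]_x (phi0 om x * \1_A x))%:E.
Proof.
move=> mA; have phiA := integrable_indicM mA (B_integrable (phi0_B hS om)).
rewrite /Rintegral fineK; last exact: integrable_fin_num.
rewrite /mu0 integral_mkcond; apply: eq_integral => x _.
by rewrite patchE indicE; case: (_ \in _); rewrite ?mulr1 ?mulr0.
Qed.

Lemma mu0_le om (A A' : set (borel X)) : measurable A -> measurable A' ->
  A `<=` A' -> (mu0 om A <= mu0 om A')%E.
Proof.
move=> mA mA' AA'; apply: ge0_subset_integral => //.
  apply: measurable_funTS; apply/measurable_EFinP; exact: B_measurable (phi0_B hS om).
by move=> x _; rewrite lee_fin phi0_ge0.
Qed.

Lemma mu0_ge0 om (A : set X) : (0 <= mu0 om A)%E.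
Proof. by apply: integral_ge0 => x _; rewrite lee_fin phi0_ge0. Qed.

Lemma mu0U om (A A' : set (borel X)) : measurable A -> measurable A' ->
  A `&` A' = set0 -> mu0 om (A `|` A') = (mu0 om A + mu0 om A')%E.
Proof.
move=> mA mA' AA'; apply: ge0_integral_setU => //.
- apply: measurable_funTS; apply/measurable_EFinP; exact: B_measurable (phi0_B hS om).
- by move=> x _; rewrite lee_fin phi0_ge0.
- by apply/disj_setPS; rewrite AA'.
Qed.

Lemma mu0_setI_J om (A : set (borel X)) : measurable A ->
  mu0 om A = mu0 om (J om `&` A).
Proof.
move=> mA; rewrite !mu0E//; last exact: measurableI (measurable_J om) mA.
congr EFin; apply: eq_Rintegral => x _.
have [Jx|nJx] := pselect (J om x); last by rewrite (B_out (phi0_B hS om)) ?mul0r.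
congr (_ * _); rewrite !indicE; congr (_%:R); congr (nat_of_bool _).
by apply/idP/idP; rewrite !inE; [split|case].
Qed.

(** [phi0] is measurable on [J0] and vanishes off it, hence is jointly measurable; integration
    against the kernel [nu0] then gives a measurable function of [om]. *)
Lemma measurable_mu0 (E : set (Om * borel X)) : measurable E ->
  measurable_fun setT (fun om => mu0 om [set x | E (om, x)]).
Proof.
move=> mE.
pose k (p : Om * borel X) : \bar R := (phi0 p.1 p.2 * \1_E p)%:E.
have mphi : measurable_fun setT (fun p : Om * borel X => phi0 p.1 p.2).
  have h := phi0_measurable hS; rewrite -(setUv (J0 S)).
  apply/measurable_funU.
  - exact: (J0_measurable hS).
  - exact: measurableC (J0_measurable hS).
  - split; first exact: h.
    apply: (eq_measurable_fun (cst (0 : R))) => //.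
    by move=> [om x]; rewrite inE /= => nJ; rewrite (B_out (phi0_B hS om)) .
have := @measurable_fun_integral_finite_kernel _ _ Om (borel X) R k nu0.
move=> /(_ _ _)/=; rewrite (_ : (fun om => mu0 om _) =
   fun om => (\int[nu0 om]_y k (om, y))%E).
  apply.
  - by move=> [om x]; rewrite lee_fin mulr_ge0// phi0_ge0.
  - by apply/measurable_EFinP; apply: measurable_funM.
apply/funext => om; rewrite /mu0 integral_mkcond; apply: eq_integral => x _.
rewrite patchE /k indicE /=.
have -> : (x \in [set x0 | E (om, x0)]) = ((om, x) \in E).
  by apply/idP/idP; rewrite !inE.
by case: (_ \in _); rewrite ?mulr1 ?mulr0.
Qed.

(** Invariance is assumed only after integration over [m]. It is tested on [EG], the part of [E]
    over base points whose preimage under [sg] lies in [G]. This equates the integrals of both sides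
    over every measurable [G], and so the sides almost everywhere. *)
Lemma mu0_invariant_fibre (E : set (Om * borel X)) : measurable E ->
  {ae m, forall om,
    mu0 om [set x | skew_preimage E (om, x)] = mu0 (sg om) [set x | E (sg om, x)]}.
Proof.
move=> mE; have mP := measurable_skew_preimage mE.
pose u om := mu0 om [set x | skew_preimage E (om, x)].
pose w om := mu0 om [set x | E (om, x)].
have mu : measurable_fun setT u := measurable_mu0 mP.
have mw : measurable_fun setT w := measurable_mu0 mE.
have mv : measurable_fun setT (w \o sg) := measurableT_comp mw (measurable_sg hS).
have u0 om : (0 <= u om)%E by exact: mu0_ge0.
have ui : m.-integrable setT u.
  apply/integrableP; split=> //.
  apply: (@le_lt_trans _ _ (\int[m]_x cst 1 x)%E); last first.
    rewrite integral_cst// mul1e.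
    by apply: le_lt_trans (ltry 1); rewrite probability_le1.
  apply: ae_ge0_le_integral => //; first exact: measurableT_comp.
  apply: filterS (mu0_probability hS) => om h _; rewrite gee0_abs// -h.
  by apply: mu0_le => //; exact: measurable_section.
suff hG G : measurable G ->
    (\int[m]_(x in G) u x = \int[m]_(x in G) (w \o sg) x)%E.
  have := @integral_ae_eq _ Om R m setT measurableT (w \o sg) u ui mv.
  by move=> /(_ (fun G _ => hG G)); apply: filterS => om /(_ I).
move=> mG.
pose EG : set (Om * borel X) := E `&` [set p | G (sgi p.1)].
have mEG : measurable EG.
  apply: measurableI => //; rewrite (_ : [set p | _] = (sgi @^-1` G) `*` setT).
    apply: measurableX => //.
    by have := measurable_sgi hS measurableT mG; rewrite setTI.
  by apply/seteqP; split=> -[om x] //= [].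
pose wG om := mu0 om [set x | EG (om, x)].
have mu0_set0 om : mu0 om set0 = 0%E by rewrite /mu0 integral_set0.
have EGE om x : EG (sg om, x) = (E (sg om, x) /\ G om).
  exact: (congr1 (fun w => E (sg om, x) /\ G w) (sgK hS om)).
transitivity (\int[m]_om mu0 om [set x | J om x /\ EG (sg om, T S om x)])%E.
  rewrite integral_mkcond; apply: eq_integral => om _; rewrite patchE.
  under eq_set do rewrite EGE.
  case: ifPn => [|/negP]; rewrite inE => Gom.
    by congr (mu0 _ _); apply/seteqP; split=> x [Jx]; [|case].
  by rewrite (_ : [set x | _] = set0)// -subset0 => x [_ []].
rewrite (mu0_invariant hS mEG : _ = \int[m]_om wG om)%E.
rewrite -(ge0_integral_preserving (measurable_sg hS) (sg_preserves hS)).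
- rewrite [RHS]integral_mkcond; apply: eq_integral => om _; rewrite patchE /wG.
  under eq_set do rewrite EGE.
  case: ifPn => [|/negP]; rewrite inE => Gom.
    by congr (mu0 _ _); apply/seteqP; split=> x; [case|].
  by rewrite (_ : [set x | _] = set0)// -subset0 => x [].
- by move=> om; exact: mu0_ge0.
- exact: measurable_mu0.
Qed.

(** * Base orbits in both directions and first returns to the hole *)

Lemma ae_sg (Q : Om -> Prop) : {ae m, forall om, Q om} ->
  {ae m, forall om, forall n, Q (iter n sg om)}.
Proof. exact: ae_iter_preserving (measurable_sg hS) (sg_preserves hS) _. Qed.

Lemma sgi_preserves A : measurable A -> m (sgi @^-1` A) = m A.
Proof.
move=> mA; rewrite -(sg_preserves hS); last first.
  by have := measurable_sgi hS measurableT mA; rewrite setTI.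
by congr (m _); apply/seteqP; split=> x /=; rewrite (sgK hS x).
Qed.

Lemma ae_sgi (Q : Om -> Prop) : {ae m, forall om, Q om} ->
  {ae m, forall om, forall n, Q (iter n sgi om)}.
Proof. exact: ae_iter_preserving (measurable_sgi hS) sgi_preserves _. Qed.

Lemma iter_sg_sgi n k om : iter (n + k) sg (iter k sgi om) = iter n sg om.
Proof.
rewrite iterD; congr (iter n sg _).
by elim: k om => // k ih om; rewrite iterSr iterS (sgiK hS) ih.
Qed.

Lemma iter_sgi_sub n k om : (k <= n)%N ->
  iter k sg (iter n sgi om) = iter (n - k) sgi om.
Proof.
move=> kn; rewrite -{1}(subnK kn) addnC iterD.
by rewrite -[k in iter k sg]add0n iter_sg_sgi.
Qed.

Lemma mu0_skew_preimage_iter (E : set (Om * borel X)) : measurable E ->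
  {ae m, forall om, forall n,
    mu0 om [set x | skew_preimage_iter n E (om, x)]
    = mu0 (iter n sg om) [set x | E (iter n sg om, x)]}.
Proof.
move=> mE; apply: ae_foralln; elim=> [|n ih].
  apply: aeW => om /=; rewrite [RHS]mu0_setI_J//; exact: measurable_section.
have := mu0_invariant_fibre (measurable_skew_preimage_iter n mE).
have := ae_comp_preserving (measurable_sg hS) (sg_preserves hS) ih.
apply: filterS2 => om h1 h2.
by rewrite skew_preimage_iterS h2 h1 -iterSr.
Qed.

(** Points of the hole whose first return takes exactly [k.+1] steps. Fibres are reached by forward
    iterates from the starting point, which makes the set jointly measurable; [qhat] names the same
    fibres by backward iterates from the end point. *)
Definition return_set e k : set (Om * borel X) := [set p |
  [/\ J p.1 p.2, H e (iter k.+1 sg p.1) (Tn k.+1 p.1 p.2),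
      forall j, (1 <= j <= k)%N ->
        ~ H e (iter (k.+1 - j) sg p.1) (Tn (k.+1 - j) p.1 p.2)
      & H e p.1 p.2]].

Lemma measurable_return_set e k : 0 < e -> measurable (return_set e k).
Proof.
move=> e0; have mh := hole_measurable hS e0.
rewrite (_ : return_set e k = skew_preimage_iter k.+1 (hole e) `&` hole e `&`
    \bigcap_(j in [set j | (1 <= j <= k)%N])
      (~` skew_preimage_iter (k.+1 - j) (hole e))).
  apply: measurableI.
    by apply: measurableI => //; exact: measurable_skew_preimage_iter.
  have [->|/set0P ne] := eqVneq [set j | (1 <= j <= k)%N] set0.
    by rewrite bigcap_set0.
  apply: bigcap_measurable => // j _.
  by apply: measurableC; exact: measurable_skew_preimage_iter.
apply/seteqP; split=> -[om x].
  move=> [/= Jx Hx hx H0]; split; first by split.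
  by move=> j /= jk [_]; exact: hx.
move=> [[[/= Jx Hx] H0] hx]; split=> // j jk Hj.
by apply: (hx j jk); split.
Qed.

Lemma qhat_numerator e k om :
  qhat S k e om =
  fine (mu0 (iter k.+1 sgi om) [set x | return_set e k (iter k.+1 sgi om, x)]) /
  fine (mu0 (iter k.+1 sgi om)
    [set x | skew_preimage_iter k.+1 (hole e) (iter k.+1 sgi om, x)]).
Proof.
have E : iter k.+1 sg (iter k.+1 sgi om) = om by rewrite iter_sgi_sub// subnn.
have ej j : (1 <= j <= k)%N ->
    iter (k.+1 - j) sg (iter k.+1 sgi om) = iter j sgi om.
  by move=> /andP[_ jk]; rewrite iter_sgi_sub ?leq_subr// subKn// leqW.
rewrite /qhat; move: (iter k.+1 sgi om) E ej => w E ej.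
congr (fine (mu0 _ _) / fine (mu0 _ _)); apply/seteqP; split=> x.
- move=> [Jx Hx hx H0]; split; [exact: Jx|by rewrite [iter _ _ _]E| |exact: H0].
  by move=> j jk; rewrite [iter _ _ _]ej//; exact: hx.
- move=> [Jx Hx hx H0]; split; [exact: Jx|by rewrite -E| |exact: H0].
  by move=> j jk; rewrite -ej//; exact: hx.
- by move=> [Jx Hx]; split; [exact: Jx|rewrite [iter _ _ _]E].
- by move=> [Jx Hx]; split; [exact: Jx|rewrite -E].
Qed.

(* Decomposes a hit of the hole at time [n.+1] according to the last previous
   time in the hole. *)
Lemma surv_diff_qhat e : 0 < e -> {ae m, forall om, forall n,
  (0 < mu0 om (H e om))%E ->
  let om' := iter n.+1 sgi om in
  fine (mu0 om' (surv e n om')) - fine (mu0 om' (surv e n.+1 om'))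
  = fine (mu0 om (H e om)) * (1 - \sum_(k < n.+1) qhat S k e om)}.
Proof.
move=> e0; have mh := hole_measurable hS e0.
have inv_hole := ae_sgi (mu0_skew_preimage_iter mh).
have inv_ret : {ae m, forall om, forall k n j,
    let om' := iter n sgi om in
    mu0 om' [set x | skew_preimage_iter j (return_set e k) (om', x)]
    = mu0 (iter j sg om') [set x | return_set e k (iter j sg om', x)]}.
  apply: ae_foralln => k.
  exact: ae_sgi (mu0_skew_preimage_iter (measurable_return_set k e0)).
apply: filterS3 inv_hole inv_ret (ae_sgi (mu0_probability hS)) => om ih ir prob n mu_gt0.
set om' := iter n.+1 sgi om.
have E : iter n.+1 sg om' = om by rewrite iter_sgi_sub// subnn.
have mu1 : mu0 om' setT = 1%E by exact: prob.
have mufin (A : set (borel X)) : measurable A -> mu0 om' A \is a fin_num.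
  by move=> mA; rewrite mu0E.
(* [W k] is a hit at time [n.+1] with the [k] times before it free of the hole. [V k] is the part of
   [W k] in the hole at time [n - k], whose removal leaves [W k.+1]. After [n.+1] removals times 0
   to [n] are all free, and [W n.+1] is what [surv e n] loses at time [n.+1]. *)
pose W k : set (borel X) := [set x | [/\ J om' x, H e om (Tn n.+1 om' x) &
  forall j, (1 <= j <= k)%N ->
    ~ H e (iter (n.+1 - j) sg om') (Tn (n.+1 - j) om' x)]].
pose V k : set (borel X) :=
  [set x | skew_preimage_iter (n - k) (return_set e k) (om', x)].
have mV k : measurable (V k).
  apply: measurable_section; apply: measurable_skew_preimage_iter.
  exact: measurable_return_set.
have VE k x : (k <= n)%N -> V k x <-> W k x /\ H e (iter (n - k) sg om') (Tn (n - k) om' x).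
  move=> kn; rewrite /V /W /skew_preimage_iter /return_set /=.
  have ek : (k.+1 + (n - k) = n.+1)%N by rewrite addSn subnKC.
  have ej j : (j <= k)%N -> (k.+1 - j + (n - k) = n.+1 - j)%N.
    by move=> jk; rewrite addnC addnBA ?leqW// addnC ek.
  have ekH : H e (iter k.+1 sg (iter (n - k) sg om'))
      (Tn k.+1 (iter (n - k) sg om') (Tn (n - k) om' x))
      = H e om (Tn n.+1 om' x).
    by rewrite -iterD -Tn_add ek E.
  have ejH j : (j <= k)%N -> H e (iter (k.+1 - j) sg (iter (n - k) sg om'))
      (Tn (k.+1 - j) (iter (n - k) sg om') (Tn (n - k) om' x))
      = H e (iter (n.+1 - j) sg om') (Tn (n.+1 - j) om' x).
    by move=> jk; rewrite -iterD -Tn_add ej.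
  split=> [[Jx [JTx Hx hx H0]]|[[Jx Hx hx] H0]].
    split=> //; split=> //; first by rewrite -ekH.
    by move=> j jk; rewrite -ejH; [exact: hx|case/andP: jk].
  split=> //; split=> //; [exact: Tn_J|by have := Hx; rewrite -ekH|].
  by move=> j jk; have := hx j jk; rewrite -ejH//; case/andP: jk.
have WS k : (k <= n)%N -> W k.+1 = W k `\` V k.
  move=> kn; apply/seteqP; split=> x.
    move=> [Jx Hx hx]; split.
      by split=> // j /andP[j1 jk]; apply: hx; rewrite j1 leqW.
    move=> /(VE _ _ kn)[_]; rewrite -subSS; apply: hx.
    by rewrite ltnS leqnn.
  move=> [[Jx Hx hx] nV]; split=> // j /andP[j1]; rewrite leq_eqVlt => /predU1P[->|].
    by rewrite subSS => h; apply: nV; apply/(VE _ _ kn).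
  by rewrite ltnS => jk; apply: hx; rewrite j1.
have VW k : (k <= n)%N -> V k `<=` W k by move=> kn x /(VE _ _ kn)[].
have mW k : (k <= n.+1)%N -> measurable (W k).
  elim: k => [_|k IH kn]; last first.
    by rewrite WS//; apply: measurableD; [apply: IH; exact: ltnW|exact: mV].
  rewrite (_ : W 0%N = [set x | skew_preimage_iter n.+1 (hole e) (om', x)]).
    by apply: measurable_section; exact: measurable_skew_preimage_iter.
  apply/seteqP; split=> x; first by move=> [Jx Hx _]; split; [exact: Jx|rewrite [iter _ _ _]E].
  by move=> [Jx Hx]; split; [exact: Jx|rewrite -E|case].
have W0 : mu0 om' (W 0%N) = mu0 om (H e om).
  have := ih n.+1 n.+1; rewrite E => <-; congr (mu0 _ _); apply/seteqP; split=> x.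
    by move=> [Jx Hx _]; split; [exact: Jx|rewrite [iter _ _ _]E].
  by move=> [Jx Hx]; split; [exact: Jx|rewrite -E|case].
have Wn : surv e n.+1 om' `|` W n.+1 = surv e n om'.
  apply/seteqP; split=> x.
    move=> [/surv_last[]//|[Jx _ hx]]; split=> // j jn.
    rewrite -(subKn (leqW jn)); apply: hx; rewrite leq_subr andbT subn_gt0.
    by rewrite ltnS.
  move=> sx; have [Hx|nHx] := pselect (H e om (Tn n.+1 om' x)).
    right; case: sx => Jx hx; split=> // j /andP[j1 jn]; apply: hx.
    by rewrite leq_subLR -addn1 addnC leq_add2r.
  by left; apply/surv_last; rewrite E.
have Wn0 : surv e n.+1 om' `&` W n.+1 = set0.
  rewrite -subset0 => x [/surv_last[_]]; rewrite E => nH [_ Hx _]; exact: nH.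
(* By invariance, [V k] has the mass of the numerator of [qhat S k e om], and the denominator is the
   mass of the hole over [om], which is positive. *)
have Vq k : (k <= n)%N -> fine (mu0 om' (V k)) = fine (mu0 om (H e om)) * qhat S k e om.
  move=> kn; rewrite qhat_numerator (ih k.+1 k.+1) iter_sgi_sub// subnn.
  have := ir k n.+1 (n - k)%N; rewrite -/om' -/(V k) => ->.
  rewrite iter_sgi_sub; last by rewrite (leq_trans (leq_subr _ _)).
  rewrite subSn ?leq_subr// subKn//= mulrC divfK// fine_eq0.
    by rewrite gt_eqF.
  by rewrite mu0E// ; exact: measurable_H.
have step k : (k <= n)%N ->
    fine (mu0 om' (W k)) = fine (mu0 om' (W k.+1)) + fine (mu0 om' (V k)).
  move=> kn; have mWk1 : measurable (W k.+1) by exact: (mW k.+1 kn).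
  rewrite -fineD; [|exact: (mufin _ mWk1)|exact: (mufin _ (mV k))].
  rewrite -mu0U; [|exact: mWk1|exact: (mV k)|].
    by rewrite (WS k kn) setUC setDUK; [|exact: VW].
  by rewrite (WS k kn) setDE -setIA setICl setI0.
have WE k : (k <= n.+1)%N ->
    fine (mu0 om' (W k)) = fine (mu0 om (H e om)) * (1 - \sum_(i < k) qhat S i e om).
  elim: k => [_|k IH kn]; first by rewrite W0 big_ord0 subr0 mulr1.
  have := step k kn; rewrite (IH (ltnW kn)) => h.
  rewrite (Vq k kn) in h; rewrite big_ord_recr opprD addrA mulrDr h mulrN.
  by rewrite addrK.
rewrite -(WE n.+1 (leqnn n.+1)) -Wn mu0U//; [|exact: measurable_surv|exact: mW].
rewrite fineD; first by rewrite addrAC subrr add0r.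
  by apply: mufin; exact: measurable_surv.
by apply: mufin; exact: mW.
Qed.

End open_system.

(** * Perturbed transfer operators *)

Section perturbation.
Context {R : realType} {dO : measure_display} {Om : measurableType dO}
  {X : completePseudoMetricType R}.
Variables (m : probability Om R) (S : system_data Om X) (P : perturbation_data Om X).
Hypothesis hS : random_open_system m S.
Implicit Types (e : R) (om : Om) (f h : X -> R).

Local Notation sg := (sg S).
Local Notation J := (J S).
Local Notation B := (B S).
Local Notation nu0 := (nu0 S).
Local Notation lam0 := (lam0 S).
Local Notation H := (H S).
Local Notation surv := (surv S).
Local Notation Le := (Le S).
Local Notation Ln := (Ln S).
Local Notation prod_iter := (prod_iter S).
Hypothesis hC2 : cond_C2 m S P.
Hypothesis hC3 : cond_C3 m S P.
Local Notation nu := (nu P).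
Local Notation lam := (lam P).
Local Notation phi := (phi P).
Local Notation Q := (Q P).
Local Notation Qn := (Qn S P).

Lemma lam0_gt0 om : 0 < lam0 om.
Proof. by rewrite -(lam_at0 hC2); exact: (lam_gt0 hC2). Qed.

Lemma prod_iter_gt0 (l : Om -> R) n om : (forall w, 0 < l w) -> 0 < prod_iter l n om.
Proof. by move=> l0; apply: prodr_gt0. Qed.

Definition normalized e om := \int[nu0 om]_x phi e om x = 1.

Definition decomposed e om :=
  [/\ forall f, B om f -> forall x, (lam e om)^-1 * Le e om f x
        = (\int[nu e om]_y f y) * phi e (sg om) x + Q e om f x,
      forall x, Q e om (phi e om) x = 0 &
      forall f, B om f -> \int[nu e (sg om)]_x Q e om f x = 0].

Lemma ae_normalized e : 0 <= e -> {ae m, forall om, normalized e om}.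
Proof. by move=> e0; apply: filterS (nu0_phi hC2 e0) => om []. Qed.

Lemma ae_decomposed e : 0 <= e -> {ae m, forall om, decomposed e om}.
Proof. exact: (Q_decomposition hC3). Qed.

(* the relative drop of the eigenvalue, see [lam_drop] *)
Definition hole_mass e om := \int[nu0 om]_x (phi e om x * \1_(H e om) x).

Lemma Rintegral_indicC om e f : 0 < e -> B om f ->
  \int[nu0 om]_x (f x * \1_(surv e 0 om) x) + \int[nu0 om]_x (f x * \1_(H e om) x)
  = \int[nu0 om]_x f x.
Proof.
move=> e0 Bf; have fi := B_integrable hS Bf.
rewrite -RintegralD//; first last.
- exact: integrable_indicM (measurable_H hS om e0) fi.
- exact: integrable_indicM (measurable_surv hS 0 om e0) fi.
apply: eq_Rintegral => x _; have [Jx|nJx] := pselect (J om x); last first.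
  by rewrite (B_out hS Bf nJx) !mul0r addr0.
rewrite -mulrDr surv0E// !indicE /Je e0 in_setD.
by rewrite (mem_set Jx)/=; case: (x \in H e om); rewrite ?(add0r, addr0) mulr1.
Qed.

(** Integrate the eigenvalue equation of [phi e] against [nu0]. Normalisation at [sg om] leaves
    [lam e om] on one side; on the other, conformality gives [lam0 om] times the integral of
    [phi e om] outside the hole, and normalisation at [om] applies. *)
Lemma lam_drop e om : 0 < e -> normalized e om -> normalized e (sg om) ->
  lam e om = lam0 om * (1 - hole_mass e om).
Proof.
move=> e0 h1 h2; have Bphi := phi_B hC2 (ltW e0) om.
rewrite -h1 -(Rintegral_indicC e0 Bphi) addrK.
rewrite -(nu0_conformal_surv hS 0 e0 Bphi) -[LHS]mulr1 -h2.
rewrite -RintegralZl//; last first.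
  exact: (B_integrable hS (phi_B hC2 (ltW e0) _)).
by apply: eq_Rintegral => x _; rewrite surv0E// -(Le_phi hC2 (ltW e0)).
Qed.

Lemma Qn_B e n om f : 0 <= e -> B om f -> B (iter n sg om) (Qn e n om f).
Proof. by move=> e0 Bf; elim: n => //= n ih; exact: (Q_B hC3). Qed.

Lemma Q0 e om : 0 <= e -> Q e om (fun=> 0) = fun=> 0.
Proof.
move=> e0; have B0 : B om (fun=> 0).
  have := B_scale hS 0 (phi0_B hS om).
  by under [X in B om X]eq_fun do rewrite mul0r.
apply/funext => x; have := Q_linear hC3 e0 (-1) B0 B0.
under [X in Q e om X]eq_fun do rewrite mulr0 addr0.
by move=> /(congr1 (@^~ x)); lra.
Qed.

Lemma Q_scale e om a f : 0 <= e -> B om f ->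
  Q e om (fun x => a * f x) = (fun x => a * Q e om f x).
Proof.
move=> e0 Bf; have B0 : B om (fun=> 0).
  have := B_scale hS 0 (phi0_B hS om).
  by under [X in B om X]eq_fun do rewrite mul0r.
have := Q_linear hC3 e0 a Bf B0; rewrite Q0//.
under [X in Q e om X]eq_fun do rewrite addr0.
by under [X in _ = X -> _]eq_fun do rewrite addr0.
Qed.

Lemma Rintegral_nu_Ln e n om f : 0 < e -> B om f ->
  \int[nu e (iter n sg om)]_x Ln e n om f x
  = prod_iter (lam e) n om * \int[nu e om]_x f x.
Proof.
move=> e0 Bf; elim: n => [|n ih]; first by rewrite /prod_iter big_ord0 mul1r.
rewrite prod_iterS -mulrA mulrCA -ih -(nu_Le hC2 (ltW e0))//.
exact: (Ln_B hS).
Qed.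

(** In the inductive step (C3) is applied to the previous iterate: its [nu e]-integral follows from
    conformality of [nu e], and [Q e] annihilates its [phi e] component, so only the next [Qn]
    remains. The count starts at one since [Qn e 0 om f] is [f] itself. *)
Lemma Ln_decomposition e n om f : 0 < e ->
  (forall k, decomposed e (iter k sg om)) -> B om f ->
  forall x, Ln e n.+1 om f x = prod_iter (lam e) n.+1 om
    * ((\int[nu e om]_y f y) * phi e (iter n.+1 sg om) x + Qn e n.+1 om f x).
Proof.
move=> e0 dec Bf; have lamN0 w : lam e w != 0 by rewrite gt_eqF// (lam_gt0 hC2)// ltW.
have step k h x : B (iter k sg om) h -> Le e (iter k sg om) h x =
    lam e (iter k sg om) * ((\int[nu e (iter k sg om)]_y h y)
      * phi e (iter k.+1 sg om) x + Q e (iter k sg om) h x).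
  move=> Bh; have [D1 _ _] := dec k.
  by rewrite -D1// mulrA divff// mul1r.
elim: n => [x|n ih x].
  by rewrite prod_iterS /prod_iter big_ord0 mul1r -step.
have BL : B (iter n.+1 sg om) (Ln e n.+1 om f) by exact: (Ln_B hS).
rewrite [LHS](step n.+1 _ x BL) Rintegral_nu_Ln// [prod_iter _ n.+2 _]prod_iterS.
rewrite (_ : Q e _ _ x = prod_iter (lam e) n.+1 om * Qn e n.+2 om f x); last first.
  have [_ D2 _] := dec n.+1; rewrite (funext ih).
  have BQ : B (iter n.+1 sg om) (Qn e n.+1 om f) by exact: Qn_B (ltW e0) Bf.
  rewrite Q_scale ?ltW//; last first.
    by apply: (B_add hS) => //; apply: (B_scale hS) => //; exact: (phi_B hC2 (ltW e0)).
  by rewrite (Q_linear hC3 (ltW e0) _ (phi_B hC2 (ltW e0) _) BQ) D2 mulr0 add0r.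
by ring.
Qed.

Lemma surv_mass e n om f : 0 < e -> (forall k, decomposed e (iter k sg om)) ->
  normalized e (iter n.+1 sg om) -> B om f ->
  prod_iter lam0 n.+1 om * \int[nu0 om]_x (f x * \1_(surv e n om) x)
  = prod_iter (lam e) n.+1 om * (\int[nu e om]_y f y
      + \int[nu0 (iter n.+1 sg om)]_x Qn e n.+1 om f x).
Proof.
move=> e0 dec h1 Bf; have e0' := ltW e0.
have BQ : B (iter n.+1 sg om) (Qn e n.+1 om f) by exact: Qn_B.
have Bp : B (iter n.+1 sg om) (phi e (iter n.+1 sg om)) by exact: (phi_B hC2).
rewrite -(Rintegral_Ln hS)//; under eq_Rintegral do rewrite Ln_decomposition//.
rewrite RintegralZl//; last first.
  by apply: (B_integrable hS); apply: (B_add hS) => //; exact: (B_scale hS).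
rewrite RintegralD//; last exact: (B_integrable hS).
  by rewrite RintegralZl ?h1 ?mulr1//; exact: (B_integrable hS).
by apply: (B_integrable hS); exact: (B_scale hS).
Qed.

(** The difference on the left is carried by the points that first meet the hole at time [n.+1].
    Conformality turns it into the integral of [Ln e n.+1 om f] over the hole, where the [phi e]
    component of [Ln_decomposition] contributes [hole_mass]. *)
Lemma hole_return_mass e n om f : 0 < e -> (forall k, decomposed e (iter k sg om)) ->
  B om f ->
  prod_iter lam0 n.+1 om * (\int[nu0 om]_x (f x * \1_(surv e n om) x)
                            - \int[nu0 om]_x (f x * \1_(surv e n.+1 om) x))
  = prod_iter (lam e) n.+1 om
    * ((\int[nu e om]_y f y) * hole_mass e (iter n.+1 sg om)
      + \int[nu0 (iter n.+1 sg om)]_x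
          (Qn e n.+1 om f x * \1_(H e (iter n.+1 sg om)) x)).
Proof.
move=> e0 dec Bf; have e0' := ltW e0.
have BQ : B (iter n.+1 sg om) (Qn e n.+1 om f) by exact: Qn_B.
have Bp : B (iter n.+1 sg om) (phi e (iter n.+1 sg om)) by exact: (phi_B hC2).
have BL : B (iter n.+1 sg om) (Ln e n.+1 om f) by exact: (Ln_B hS).
have mH := measurable_H hS (iter n.+1 sg om) e0.
rewrite mulrBr -(Rintegral_Ln hS)// -[in surv e n.+1 om](addn0 n.+1) -(Rintegral_Ln_surv hS)//.
rewrite -(Rintegral_indicC e0 BL) addrC addKr.
under eq_Rintegral do rewrite Ln_decomposition// -mulrA mulrDl -mulrA.
have i1 := integrable_indicM mH (B_integrable hS Bp).
have i2 := integrable_indicM mH (B_integrable hS BQ).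
rewrite RintegralZl//; last first.
  have := integrableD measurableT (integrableZl measurableT (\int[nu e om]_y f y) i1) i2.
  by [].
rewrite RintegralD//; last by have := integrableZl measurableT (\int[nu e om]_y f y) i1.
by rewrite RintegralZl.
Qed.

End perturbation.

(** * Vanishing holes *)

Section limits.

Context {R : realType} {dO : measure_display} {Om : measurableType dO}
  {X : completePseudoMetricType R}.
Variables (m : probability Om R) (S : system_data Om X) (P : perturbation_data Om X).
Hypothesis hS : random_open_system m S.
Implicit Types (e : R) (om : Om) (f h : X -> R).

Local Notation sg := (sg S).
Local Notation sgi := (sgi S).
Local Notation J := (J S).
Local Notation B := (B S).
Local Notation nB := (nB S).
Local Notation nu0 := (nu0 S).
Local Notation lam0 := (lam0 S).
Local Notation phi0 := (phi0 S).
Local Notation hole := (hole S).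
Local Notation H := (H S).
Local Notation Tn := (Tn S).
Local Notation surv := (surv S).
Local Notation mu0 := (mu0 S).
Local Notation prod_iter := (prod_iter S).
Local Notation nu := (nu P).
Local Notation lam := (lam P).
Local Notation phi := (phi P).
Local Notation Qn := (Qn S P).
Local Notation hole_mass := (hole_mass S P).
Hypothesis hC2 : cond_C2 m S P.
Hypothesis hC3 : cond_C3 m S P.
Hypothesis hC4 : cond_C4 m S P.
Hypothesis hC5 : cond_C5 m S P.
Hypothesis hC6 : cond_C6 m S.
Hypothesis hC7 : cond_C7 m S P.
Hypothesis hC8 : cond_C8 m S.

Definition muH e om := fine (mu0 om (H e om)).
Definition nuH e om := fine (nu0 om (H e om)).

Lemma ae_phi_le : exists C2 : Om -> R,
  [/\ measurable_fun setT C2, forall om, 1 <= C2 om & {ae m, forall om,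
    [/\ forall e, 0 <= e -> {ae nu0 om, forall x, `|phi e om x| <= C2 om},
        {ae nu0 om, forall x, `|phi0 om x| <= C2 om} & nB om (phi0 om) <= C2 om]}].
Proof.
have [C2 [mC2 C21 hC]] := hC5; exists C2; split=> //.
apply: filterS hC => om [hphi hB].
have ae_le e : 0 <= e -> {ae nu0 om, forall x, `|phi e om x| <= C2 om}.
  by move=> e0; apply: (ae_le_Lnorm_oo (nu0_setT S om)); exact: hphi.
split=> //; have := ae_le 0 (lexx 0).
by rewrite (_ : phi 0 om = phi0 om)//; apply/funext => x; exact: (phi_at0 hC2).
Qed.

Lemma muH_ge0 e om : 0 <= muH e om.
Proof. by apply: fine_ge0; exact: (mu0_ge0 hS). Qed.

Lemma muHE e om : 0 < e -> mu0 om (H e om) = (muH e om)%:E.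
Proof.
by move=> e0; rewrite /muH fineK// (mu0E hS)//; exact: (measurable_H hS).
Qed.

Lemma muH_gt0 e om : 0 < e -> (0 < mu0 om (H e om))%E = (0 < muH e om).
Proof. by move=> e0; rewrite muHE// lte_fin. Qed.

Lemma muH_le e om (c : R) : 0 < e -> 0 <= c ->
  {ae nu0 om, forall x, `|phi0 om x| <= c} -> muH e om <= c * nuH e om.
Proof.
move=> e0 c0 hc; have mH := measurable_H hS om e0.
rewrite /muH (mu0E hS)//= (le_trans (ler_norm _))//.
apply: normr_Rintegral_indicM_le => //; first exact: nu0_setT.
exact: (B_measurable hS (phi0_B hS om)).
Qed.

(** Allows quantities of order [nuH] to be divided by [muH]. *)
Lemma nuH_le e om (c : R) : 0 < e -> 0 < c ->
  (forall x, J om x -> c^-1 <= phi0 om x) -> nuH e om <= c * muH e om.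
Proof.
move=> e0 c0 hc; have mH := measurable_H hS om e0.
have phiH := integrable_indicM mH (B_integrable hS (phi0_B hS om)).
rewrite /muH (mu0E hS)//= -RintegralZl// /nuH -Rintegral_indic//.
apply: le_Rintegral => //.
- apply: (integrable_ae_le (nu0_setT S om) (c := 1)); first exact: measurable_indic.
  by apply: aeW => x; rewrite indicE; case: (_ \in _); rewrite ?normr0 ?normr1.
- by have := integrableZl measurableT c phiH.
move=> x _; rewrite !indicE.
case: (boolP (x \in H e om)) => [|_]; rewrite ?mulr0// inE => /(hole_J0 hS e0) Jx.
by rewrite mulr1 -ler_pdivrMl// mulr1; exact: hc.
Qed.

Lemma hole_mass_le e om (c : R) : 0 < e -> 0 <= c ->
  {ae nu0 om, forall x, `|phi e om x| <= c} -> `|hole_mass e om| <= c * nuH e om.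
Proof.
move=> e0 c0 hc; apply: normr_Rintegral_indicM_le => //.
- exact: nu0_setT.
- exact: (measurable_H hS).
- exact: (B_measurable hS (phi_B hC2 (ltW e0) om)).
Qed.

Section sequence.
Variable u : nat -> R.
Hypothesis u0 : forall k, 0 < u k.
Hypothesis ucvg : u k @[k --> \oo] --> 0^'+.

Lemma nuH_cvg0 : {ae m, forall om, nuH (u k) om @[k --> \oo] --> 0}.
Proof.
apply: filterS hC6 => om /fine_cvgP[_ h].
exact: (cvg_comp _ _ ucvg h).
Qed.

Lemma hole_mass_cvg0 : {ae m, forall om, hole_mass (u k) om @[k --> \oo] --> 0}.
Proof.
have [C2 [_ C21 hC]] := ae_phi_le.
apply: filterS2 hC nuH_cvg0 => om [hphi _ _] hnu.
have C2nu : C2 om * nuH (u k) om @[k --> \oo] --> 0.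
  by rewrite -[X in _ --> X](mulr0 (C2 om)); apply: cvgM => //; exact: cvg_cst.
apply: cvg0_le_norm C2nu _ => k; apply: hole_mass_le => //.
  by rewrite (le_trans ler01).
exact/hphi/ltW.
Qed.

Lemma muH_cvg0 : {ae m, forall om, muH (u k) om @[k --> \oo] --> 0}.
Proof.
have [C2 [_ C21 hC]] := ae_phi_le.
apply: filterS2 hC nuH_cvg0 => om [_ hphi _] hnu.
have C2nu : C2 om * nuH (u k) om @[k --> \oo] --> 0.
  by rewrite -[X in _ --> X](mulr0 (C2 om)); apply: cvgM => //; exact: cvg_cst.
apply: cvg0_le_norm C2nu _ => k; rewrite ger0_norm ?muH_ge0//; apply: muH_le => //.
by rewrite (le_trans ler01).
Qed.

Lemma lam_cvg : {ae m, forall om, lam (u k) om @[k --> \oo] --> lam0 om}.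
Proof.
have nrm : {ae m, forall om, forall k n, normalized S P (u k) (iter n sg om)}.
  by apply: ae_foralln => k; apply: (ae_sg hS); exact: (ae_normalized hC2 (ltW (u0 k))).
apply: filterS2 nrm hole_mass_cvg0 => om hn h0.
rewrite (_ : (fun k => _) = fun k => lam0 om * (1 - hole_mass (u k) om)); last first.
  by apply/funext => k; exact: (lam_drop hS hC2 (u0 k) (hn k 0) (hn k 1)).
rewrite -[X in _ --> X]mulr1; apply: cvgM; first exact: cvg_cst.
by rewrite -[X in _ --> X]subr0; apply: cvgB => //; exact: cvg_cst.
Qed.

Lemma prod_iter_lam_cvg : {ae m, forall om, forall n,
  prod_iter (lam (u k)) n om @[k --> \oo] --> prod_iter lam0 n om}.
Proof.
apply: filterS (ae_sg hS lam_cvg) => om h; elim=> [|n ih].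
  by rewrite /prod_iter big_ord0; under eq_fun do rewrite big_ord0; exact: cvg_cst.
by rewrite prod_iterS; under eq_fun do rewrite prod_iterS; exact: cvgM.
Qed.

Definition surv_mu e N om := fine (mu0 om (surv e N om)).

Lemma surv_mu_le1 e N om : 0 < e -> mu0 om setT = 1%E -> surv_mu e N om <= 1.
Proof.
move=> e0 h1; rewrite -lee_fin /surv_mu fineK.
  by rewrite -h1 (mu0_le hS)//; exact: (measurable_surv hS).
by rewrite (mu0E hS)//; exact: (measurable_surv hS).
Qed.

(** A union bound: a point fails to survive by being in the hole at one of the times 0 to [N], and
    by invariance the event at time [j] has the mass of the hole over [iter j sg om]. *)
Lemma surv_mu_ge e : 0 < e -> {ae m, forall om, forall N,
  1 - \sum_(j < N.+1) muH e (iter j sg om) <= surv_mu e N om}.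
Proof.
move=> e0; have mh := hole_measurable hS e0.
apply: filterS2 (mu0_skew_preimage_iter hS mh) (mu0_probability hS) => om inv h1 N.
have mS N' : measurable (surv e N' om : set (borel X)) by exact: (measurable_surv hS).
pose Z j : set (borel X) := [set x | skew_preimage_iter S j (hole e) (om, x)].
have mZ j : measurable (Z j).
  exact: (measurable_section om (measurable_skew_preimage_iter hS j mh)).
have Zfin j : mu0 om (Z j) \is a fin_num by rewrite (mu0E hS).
have Sfin j : mu0 om (surv e j om) \is a fin_num by rewrite (mu0E hS).
have ZE j : muH e (iter j sg om) = fine (mu0 om (Z j)) by rewrite /muH -[mu0 _ (H e _)]inv.
have le_add (A C D : set (borel X)) : measurable A -> measurable C -> measurable D ->
    A `<=` C `|` D -> fine (mu0 om A) <= fine (mu0 om C) + fine (mu0 om D).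
  move=> mA mC mD ACD.
  have fn (E : set (borel X)) : measurable E -> mu0 om E \is a fin_num.
    by move=> mE; rewrite (mu0E hS).
  have mDC := measurableD mD mC.
  rewrite -lee_fin EFinD !fineK ?fn//.
  apply: (@le_trans _ _ (mu0 om C + mu0 om (D `\` C))%E).
    rewrite -(mu0U hS)//; last by rewrite setDIK.
    apply: (mu0_le hS) => //; first exact: measurableU.
    by move=> x /ACD [Cx|Dx]; [left|have [Cx|nCx] := pselect (C x); [left|right]].
  by rewrite leeD2l// (mu0_le hS)//; apply: subDsetl.
have J1 : fine (mu0 om (J om)) = 1.
  by have := mu0_setI_J hS om measurableT; rewrite setIT h1 => <-.
elim: N => [|N ih].
  rewrite big_ord1 ZE lerBlDr -J1; apply: le_add => //; first exact: (measurable_J hS).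
  move=> x Jx; have [Hx|nHx] := pselect (H e om x); first by right; split.
  by left; split=> // j; rewrite leqn0 => /eqP ->.
rewrite big_ord_recr/= opprD addrA lerBlDr (le_trans ih)// [muH _ _](ZE N.+1); apply: le_add => //.
move=> x sx; have [Hx|nHx] := pselect (H e (iter N.+1 sg om) (Tn N.+1 om x)).
  by right; split=> //; case: sx.
by left; apply/surv_last.
Qed.

Lemma surv_mu_cvg1 : {ae m, forall om, forall N, surv_mu (u k) N om @[k --> \oo] --> (1 : R)}.
Proof.
have ge : {ae m, forall om, forall k N,
    1 - \sum_(j < N.+1) muH (u k) (iter j sg om) <= surv_mu (u k) N om}.
  by apply: ae_foralln => k; exact: surv_mu_ge.
apply: filterS3 ge (ae_sg hS muH_cvg0) (mu0_probability hS) => om hge h0 h1 N.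
apply: (squeeze_cvgr (f := fun k => 1 - \sum_(j < N.+1) muH (u k) (iter j sg om)) (h := cst 1)).
- by apply: nearW => k; rewrite hge/= surv_mu_le1.
- rewrite -[X in _ --> X]subr0; apply: cvgB; first exact: cvg_cst.
  rewrite [X in _ --> X](_ : 0 = \sum_(j < N.+1) 0); last by rewrite big1.
  exact: (cvg_sum_ord (f := fun j k => muH (u k) (iter j sg om)) (l := fun=> 0)) h0.
- exact: cvg_cst.
Qed.

End sequence.

(** * Uniform decay of the remainder and the limit [theta0] *)

Lemma ae_Qn_phi0_le : exists (Cf : Om -> R) (alpha : Om -> nat -> R),
  [/\ forall om, 0 < Cf om, forall om N, 0 < alpha om N,
      forall om, alpha om N @[N --> \oo] --> (0 : R) &
  {ae m, forall om, forall N e, 0 <= e ->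
    {ae nu0 (iter N sg om), forall x,
      `|Qn e N om (phi0 om) x| <= Cf om * alpha om N * nB om (phi0 om)} /\
    let om' := iter N sgi om in
    {ae nu0 om, forall x,
      `|Qn e N om' (phi0 om') x| <= Cf om * alpha om N * nB om' (phi0 om')}}].
Proof.
have [Cf [alpha [[_ Cf0] [_ alpha0] alphacvg hC]]] := hC4 (phi0_B hS).
exists Cf, alpha; split=> //; apply: filterS hC => om [h1 h2 _ _] N e e0.
split; apply: (ae_le_Lnorm_oo (nu0_setT S _)); [exact: h1|exact: h2].
Qed.

(** Each point lies in a sublevel set of [C] at some natural level, and Poincare recurrence for
    [sgi] holds simultaneously for these countably many sets. *)
Lemma ae_recurrence (C : Om -> R) : measurable_fun setT C ->
  {ae m, forall om, exists K : R, forall N,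
    exists2 n, (N <= n)%N & C (iter n sgi om) <= K}.
Proof.
move=> mC; have : {ae m, forall om, forall k : nat, C om <= k%:R -> forall N,
    exists2 n, (N <= n)%N & C (iter n sgi om) <= k%:R}.
  apply: ae_foralln => k.
  have mE : measurable [set om | C om <= k%:R].
    rewrite -[X in measurable X]setTI (_ : [set om | _] = C @^-1` `]-oo, k%:R]%classic).
      exact: mC.
    by apply/seteqP; split=> om /=; rewrite in_itv.
  exact: (poincare_recurrence (measurable_sgi hS) (sgi_preserves hS) mE).
apply: filterS => om h; exists (Num.truncn `|C om|).+1%:R; apply: h.
by rewrite (le_trans (ler_norm _))// ltW// truncnS_gt.
Qed.

Lemma ae_phi0_ge : exists C3 : Om -> R, (forall om, 1 <= C3 om) /\
  {ae m, forall om, forall x, J om x -> (C3 om)^-1 <= phi0 om x}.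
Proof.
have [C3 [_ C31 h _]] := hC7; exists C3; split=> //; apply: filterS h => om h x Jx.
by rewrite -lee_fin (le_trans h)//; apply: ereal_inf_lbound; exists x.
Qed.

Section sequence.
Variable u : nat -> R.
Hypothesis u0 : forall k, 0 < u k.
Hypothesis ucvg : u k @[k --> \oo] --> 0^'+.

Let ae_decomposed_u :
  {ae m, forall om, forall k n, decomposed S P (u k) (iter n sg om)}.
Proof.
by apply: ae_foralln => k; apply: (ae_sg hS); exact: (ae_decomposed hC3 (ltW (u0 k))).
Qed.

Let ae_normalized_u :
  {ae m, forall om, forall k n, normalized S P (u k) (iter n sg om)}.
Proof.
by apply: ae_foralln => k; apply: (ae_sg hS); exact: (ae_normalized hC2 (ltW (u0 k))).
Qed.

Lemma prod_ratio_cvg1 : {ae m, forall om, forall n,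
  prod_iter lam0 n om / prod_iter (lam (u k)) n om @[k --> \oo] --> (1 : R)}.
Proof.
apply: filterS (prod_iter_lam_cvg u0 ucvg) => om h n.
have l0 : prod_iter lam0 n om != 0.
  by rewrite gt_eqF// prod_iter_gt0// => w; exact: (lam0_gt0 hC2).
rewrite -[X in _ --> X](divff l0); apply: cvgM; first exact: cvg_cst.
exact: cvgV.
Qed.

(** In [surv_mass] for [phi0] the remainder is small, uniformly in the hole, once [n] is large. For
    that fixed [n] the survivor mass and the ratio of eigenvalue products tend to 1. *)
Lemma nu_phi0_cvg1 :
  {ae m, forall om, \int[nu (u k) om]_x phi0 om x @[k --> \oo] --> (1 : R)}.
Proof.
have [Cf [alpha [Cf0 alpha0 alphacvg hQ]]] := ae_Qn_phi0_le.
apply: filterS2 (filterI ae_decomposed_u ae_normalized_u)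
  (filterI (filterI prod_ratio_cvg1 (surv_mu_cvg1 u0 ucvg)) hQ).
move=> om [dec nrm] [[ratio sm] Qle]; apply: cvg_approx => e e0.
have Cnu0 : 0 <= Cf om * nB om (phi0 om).
  by apply: mulr_ge0; [exact: ltW|exact: (nB_ge0 hS (phi0_B hS om))].
have [n hn] : exists n, Cf om * alpha om n.+1 * nB om (phi0 om) <= e.
  have : Cf om * nB om (phi0 om) * alpha om n @[n --> \oo] --> (0 : R).
    rewrite -[X in _ --> X](mulr0 (Cf om * nB om (phi0 om))).
    by apply: cvgM => //; exact: cvg_cst.
  move=> /cvgrPdist_le/(_ e e0)[N _ /(_ N.+1 (leqnSn N))]; rewrite sub0r normrN => h.
  by exists N; rewrite mulrAC (le_trans (ler_norm _)).
exists (fun k => prod_iter lam0 n.+1 om / prod_iter (lam (u k)) n.+1 om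
                 * surv_mu (u k) n om), 1.
split; last 2 first.
- by rewrite subrr normr0 ltW.
- move=> k; have lk : prod_iter (lam (u k)) n.+1 om != 0.
    by rewrite gt_eqF// prod_iter_gt0// => w; exact: (lam_gt0 hC2 (ltW (u0 k))).
  have := surv_mass hS hC2 hC3 (u0 k) (dec k) (nrm k n.+1) (phi0_B hS om).
  rewrite /surv_mu (mu0E hS)/=; last exact: (measurable_surv hS).
  move=> h; rewrite mulrAC h mulrAC divff// mul1r addrAC subrr add0r.
  have [Qn_le _] := Qle n.+1 (u k) (ltW (u0 k)).
  apply: le_trans hn; have BQ := Qn_B hC3 n.+1 (ltW (u0 k)) (phi0_B hS om).
  apply: (normr_Rintegral_le (nu0_setT S _) (B_measurable hS BQ) _ Qn_le).
  by rewrite mulrAC mulr_ge0// ltW.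
- by rewrite -[X in _ --> X]mulr1; exact: cvgM.
Qed.

Lemma hole_mass_ratio_cvg : {ae m, forall om, Omega_plus S om} ->
  {ae m, forall om, cvgn (series (fun k => qhat0 S k om)) /\
    hole_mass (u k) om / muH (u k) om @[k --> \oo] --> theta0 S om}.
Proof.
move=> Oplus.
have [C2 [mC2 C21 hC]] := ae_phi_le.
have [C3 [C31 h3]] := ae_phi0_ge.
have [Cf [alpha [Cf0 alpha0 alphacvg hQ]]] := ae_Qn_phi0_le.
have sdq : {ae m, forall om, forall k n, (0 < mu0 om (H (u k) om))%E ->
    let om' := iter n.+1 sgi om in
    surv_mu (u k) n om' - surv_mu (u k) n.+1 om'
    = muH (u k) om * (1 - \sum_(j < n.+1) qhat S j (u k) om)}.
  by apply: ae_foralln => k; exact: (surv_diff_qhat hS (u0 k)).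
have nBC : {ae m, forall om, nB om (phi0 om) <= C2 om} by apply: filterS hC => w [].
near=> om.
have Op : Omega_plus S om by near: om.
have [phi_le phi0_le _] : [/\ forall e, 0 <= e -> {ae nu0 om, forall x, `|phi e om x| <= C2 om},
  {ae nu0 om, forall x, `|phi0 om x| <= C2 om} & nB om (phi0 om) <= C2 om] by near: om.
have qcvg : forall j, cvg (qhat S j e om @[e --> 0^'+]) by move: Op; near: om.
have phi0_ge : forall x, J om x -> (C3 om)^-1 <= phi0 om x by near: om.
have Qle : forall N e, 0 <= e -> {ae nu0 om, forall x,
    `|Qn e N (iter N sgi om) (phi0 (iter N sgi om)) x|
    <= Cf om * alpha om N * nB (iter N sgi om) (phi0 (iter N sgi om))}.
  by near: om; apply: filterS hQ => om h N e e0; have [] := h N e e0.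
have sd : forall k n, (0 < mu0 om (H (u k) om))%E ->
    surv_mu (u k) n (iter n.+1 sgi om) - surv_mu (u k) n.+1 (iter n.+1 sgi om)
    = muH (u k) om * (1 - \sum_(j < n.+1) qhat S j (u k) om) by near: om.
have dec : forall i k n, decomposed S P (u k) (iter n sg (iter i sgi om)).
  by near: om; exact: (ae_sgi hS ae_decomposed_u).
have ratio : forall i n, prod_iter lam0 n (iter i sgi om)
    / prod_iter (lam (u k)) n (iter i sgi om) @[k --> \oo] --> (1 : R).
  by near: om; exact: (ae_sgi hS prod_ratio_cvg1).
have cc : forall i, \int[nu (u k) (iter i sgi om)]_x phi0 (iter i sgi om) x
    @[k --> \oo] --> (1 : R).
  by near: om; exact: (ae_sgi hS nu_phi0_cvg1).
have nBK : forall i, nB (iter i sgi om) (phi0 (iter i sgi om)) <= C2 (iter i sgi om).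
  by near: om; exact: (ae_sgi hS nBC).
have [K rec] : exists K : R, forall N, exists2 n, (N <= n)%N & C2 (iter n sgi om) <= K.
  by near: om; exact: (ae_recurrence mC2).
have mu_gt0 k : 0 < muH (u k) om by rewrite -muH_gt0//; exact: Op.
have C20 : 0 < C2 om by apply: lt_le_trans (C21 om).
have C30 : 0 < C3 om by apply: lt_le_trans (C31 om).
pose q j := qhat0 S j om.
have qc j : qhat S j (u k) om @[k --> \oo] --> q j by exact: (cvg_comp _ _ ucvg (qcvg j)).
pose sk k n := \sum_(j < n) qhat S j (u k) om.
pose s n := \sum_(j < n) q j.
have sc n : sk k n @[k --> \oo] --> s n.
  exact: (cvg_sum_ord (f := fun j k => qhat S j (u k) om)) qc.
have q_ge0 j : 0 <= q j.
  apply: (cvgn_ge (qc j)) => k; rewrite /qhat divr_ge0// fine_ge0//;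
    exact: (mu0_ge0 hS).
have sdE k n := sd k n (Op (u k) (u0 k)).
(* By [sdE] the hole mass times [1 - sk k n.+1] is the difference of two nested survivor masses. In
   the limit the partial sums of the nonnegative [q] are at most 1, which makes the series
   converge. *)
have sk_le1 k n : sk k n.+1 <= 1.
  rewrite -subr_ge0 -(pmulr_rge0 _ (mu_gt0 k)) -sdE subr_ge0.
  rewrite -lee_fin /surv_mu !fineK ?(mu0E hS)//; try exact: (measurable_surv hS).
  rewrite -!(mu0E hS); try exact: (measurable_surv hS).
  apply: (mu0_le hS); try exact: (measurable_surv hS).
  by move=> x /surv_last[].
have s_le1 n : s n.+1 <= 1 by apply: (cvgn_le (sc n.+1)).
have serE : series q = s by apply/funext => n; rewrite /series/= big_mkord.
have s_nd : nondecreasing_seq (series q).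
  by apply: nondecreasing_series => *; exact: q_ge0.
have scvg : cvgn (series q).
  apply: nondecreasing_is_cvgn => //; exists 1 => _ [n _ <-].
  by apply: le_trans (s_nd _ _ (leqnSn n)) _; rewrite serE.
split=> //.
pose r k := hole_mass (u k) om / muH (u k) om.
have r_le k : `|r k| <= C2 om * C3 om.
  rewrite normrM normfV (gtr0_norm (mu_gt0 k)) ler_pdivrMr//.
  apply: le_trans (hole_mass_le (u0 k) (ltW C20) (phi_le _ (ltW (u0 k)))) _.
  by rewrite -mulrA ler_pM2l// nuH_le.
apply: cvg_approx => e e0.
(* [Cf om * alpha om n] comes from (C4), [K] will bound the norm of [phi0] at a recurrence time, and
   [C3 om] converts [nuH] into [muH]. *)
pose err n := Cf om * alpha om n * K * C3 om.
have errc : err n @[n --> \oo] --> (0 : R).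
  rewrite -[X in _ --> X](mulr0 (Cf om * K * C3 om)).
  rewrite (_ : err = fun n => Cf om * K * C3 om * alpha om n).
    by apply: cvgM => //; exact: cvg_cst.
  by apply/funext => n; rewrite /err; ring.
have [n [n_err n_s n_K]] : exists n, [/\ err n.+1 <= e,
    `|limn (series q) - s n.+1| <= e & C2 (iter n.+1 sgi om) <= K].
  move/cvgrPdist_le : errc => /(_ e e0)[N1 _ h1].
  move/cvgrPdist_le : scvg => /(_ e e0)[N2 _ h2].
  (* Asking for a recurrence time of at least [(N1 + N2).+1] excludes time 0, so it has the form
     [n.+1]. *)
  have [[|n] Nn CK] := rec (N1 + N2).+1; first by [].
  exists n; split=> //.
    have := h1 n.+1; rewrite sub0r normrN => h; apply: le_trans (ler_norm _) (h _).
    by rewrite /= (leq_trans _ Nn)// ltnW// ltnS leq_addr.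
  by have := h2 n.+1; rewrite serE; apply; rewrite /= (leq_trans _ Nn)// ltnW// ltnS leq_addl.
set om' := iter n.+1 sgi om.
have Eom : iter n.+1 sg om' = om by rewrite /om' (iter_sgi_sub hS)// subnn.
pose c k := \int[nu (u k) om']_x phi0 om' x.
pose rt k := prod_iter lam0 n.+1 om' / prod_iter (lam (u k)) n.+1 om'.
(* Dividing the identity for the returning mass by [muH] gives [rt * (1 - sk) = c * r + I / muH], so
   this sequence differs from [r] exactly by the remainder [I / muH]. Its first term vanishes in the
   limit, as [c] tends to 1 and [r] is bounded. *)
exists (fun k => (1 - c k) * r k + rt k * (1 - sk k n.+1)), (1 - s n.+1); split.
- rewrite -[X in _ --> X]add0r -[X in _ --> 0 + X]mul1r; apply: cvgD.
    apply: (@cvg0_le_norm _ _ (fun k => `|1 - c k| * (C2 om * C3 om))).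
      rewrite -[X in _ --> X](mul0r (C2 om * C3 om)); apply: cvgM; last exact: cvg_cst.
      rewrite -[X in _ --> X](normr0 R) -(subrr 1); apply: cvg_norm.
      by apply: cvgB; [exact: cvg_cst|exact: (cc n.+1)].
    by move=> k; rewrite normrM ler_wpM2l.
  apply: cvgM; first exact: (ratio n.+1).
  by apply: cvgB; [exact: cvg_cst|exact: sc].
- by rewrite /theta0 opprB addrC addrA subrK distrC.
move=> k; have lk : prod_iter (lam (u k)) n.+1 om' != 0.
  by rewrite gt_eqF// prod_iter_gt0// => w; exact: (lam_gt0 hC2 (ltW (u0 k))).
have := hole_return_mass hS hC2 hC3 n (u0 k) (dec n.+1 k) (phi0_B hS om').
rewrite -/om' Eom => h.
have BQ : B om (Qn (u k) n.+1 om' (phi0 om')).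
  by rewrite -[X in B X]Eom; apply: (Qn_B hC3 _ (ltW (u0 k))); exact: (phi0_B hS).
set I := \int[nu0 om]_x _ in h.
have mS N : measurable (surv (u k) N om' : set (borel X)) by exact: (measurable_surv hS).
have hI : rt k * (muH (u k) om * (1 - sk k n.+1)) = c k * hole_mass (u k) om + I.
  rewrite -sdE /surv_mu !(mu0E hS)//= /rt mulrAC h.
  by rewrite mulrAC divff// mul1r.
have I_le : `|I| <= err n.+1 * muH (u k) om.
  have Qk := Qle n.+1 (u k) (ltW (u0 k)).
  have nB0 : 0 <= nB om' (phi0 om') := nB_ge0 hS (phi0_B hS om').
  have Ca0 : 0 <= Cf om * alpha om n.+1 by rewrite mulr_ge0// ltW.
  have := normr_Rintegral_indicM_le (nu0_setT S om) (measurable_H hS om (u0 k))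
    (B_measurable hS BQ) (mulr_ge0 Ca0 nB0) Qk.
  move=> /le_trans; apply; rewrite -/(nuH (u k) om).
  rewrite /err -mulrA; apply: ler_pM.
  - exact: mulr_ge0.
  - exact: fine_ge0.
  - by rewrite ler_wpM2l// (le_trans (nBK n.+1)).
  - by apply: nuH_le.
have muN0 : muH (u k) om != 0 by rewrite gt_eqF.
rewrite (_ : _ - _ = I / muH (u k) om).
  by rewrite normrM normfV (gtr0_norm (mu_gt0 k)) ler_pdivrMr// (le_trans I_le)// ler_wpM2r// ltW.
apply: (mulIf muN0); rewrite divfK// /r; move: hI.
set hm := hole_mass (u k) om; set mu := muH (u k) om; move=> hI.
have -> : ((1 - c k) * (hm / mu) + rt k * (1 - sk k n.+1) - hm / mu) * mu
  = rt k * (mu * (1 - sk k n.+1)) - c k * (hm / mu * mu) by ring.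
by rewrite hI divfK// addrAC subrr add0r.
Unshelve. all: by end_near. Qed.

End sequence.

(** * Existence and value of the escape rate *)

Definition rate e := \int[m]_w (ln (lam0 w) - ln (lam e w)).

Lemma le_rates e e' om : 0 < e -> e <= e' ->
  (lower_rate S mu0 e om <= lower_rate S mu0 e' om)%E /\
  (upper_rate S mu0 e om <= upper_rate S mu0 e' om)%E.
Proof.
move=> e0 ee'; have e'0 : 0 < e' by exact: lt_le_trans ee'.
have le N : ((N%:R^-1)%:E * lne (mu0 om (surv e' N om))
    <= (N%:R^-1)%:E * lne (mu0 om (surv e N om)))%E.
  apply: lee_wpmul2l; first by rewrite lee_fin invr_ge0.
  rewrite lee_lne; first by apply: (mu0_le hS);
    [exact: (measurable_surv hS)|exact: (measurable_surv hS)|exact: (surv_antitone hS)].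
  - by rewrite in_itv/= leey (mu0_ge0 hS).
  - by rewrite in_itv/= leey (mu0_ge0 hS).
by split; rewrite leeN2; [apply: le_limn_esup|apply: le_limn_einf].
Qed.

(** Comparing (C3) for [phi e] with its eigenvalue equation and integrating against [nu0] gives
    [phi e] integral 1 under [nu e]. If [phi0] had integral 0, so would [phi e], which vanishes
    wherever [phi0] does. Positivity is what gives the logarithm of this integral a meaning in the
    escape rate. *)
Lemma nu_phi0_gt0 e : 0 < e -> {ae m, forall om, 0 < \int[nu e om]_x phi0 om x}.
Proof.
move=> e0; have e0' := ltW e0.
have nrm := ae_sg hS (ae_normalized hC2 e0').
apply: filterS2 (ae_decomposed hC3 e0') nrm => om [D1 D2 _] nrm_om.
have Bp w : B w (phi e w) by exact: (phi_B hC2).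
have lamN0 : lam e om != 0 by rewrite gt_eqF// (lam_gt0 hC2).
have phi1 : \int[nu e om]_x phi e om x = 1.
  rewrite -[RHS](nrm_om 1%N) -[LHS]mulr1 -{1}(nrm_om 1%N) -RintegralZl//; last first.
    exact: (B_integrable hS (Bp _)).
  apply: eq_Rintegral => x _.
  have := D1 _ (Bp om) x; rewrite D2 addr0 (Le_phi hC2)// mulrA mulVf// mul1r.
  by move=> h; exact: (esym h).
have p0i := nu_B hC2 e0' (phi0_B hS om).
rewrite lt_neqAle Rintegral_ge0 ?andbT; last by move=> x _; exact: (phi0_ge0 hS).
apply/negP => /eqP /esym I0; have := @Rintegral_eq0_vanish _ _ _ (nu e om) _ (phi e om) p0i
  (phi0_ge0 hS om) _ _ I0.
rewrite phi1 => h; suff : (1 : R) = 0 by move/eqP; rewrite oner_eq0.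
apply: h.
  have := nu_B hC2 e0' (Bp om); move=> /measurable_int/measurable_EFinP; apply.
move=> x px; apply: (B_out hS (Bp om)) => Jx.
by have := phi0_gt0 hS Jx; rewrite px ltxx.
Qed.

Lemma rate_integrable e : 0 <= e ->
  m.-integrable setT (EFin \o (fun w => ln (lam0 w) - ln (lam e w))).
Proof.
by move=> e0; have := integrableB measurableT (log_lam0 hS) (log_lam hC2 e0).
Qed.

Lemma ln_prod_iter (l : Om -> R) n om : (forall w, 0 < l w) ->
  ln (prod_iter l n om) = birkhoff_sum sg (fun w => ln (l w)) n om.
Proof.
move=> l0; elim: n => [|n ih]; first by rewrite /prod_iter /birkhoff_sum !big_ord0 ln1.
rewrite prod_iterS lnM ?posrE ?prod_iter_gt0// ih /birkhoff_sum big_ord_recr//.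
Qed.

(** By [surv_mass] the logarithm of the survivor mass is minus a Birkhoff sum of
    [ln lam0 - ln lam_e] plus [ln (c + q n.+1)]. The latter converges because [c > 0] and [q] tends
    to 0, so it disappears after division by [n]. *)
Lemma ae_escape_rate e : 0 < e ->
  {ae m, forall om, is_escape_rate S mu0 e om (rate e)}.
Proof.
move=> e0; have e0' := ltW e0.
have [Cf [alpha [Cf0 alpha0 alphacvg hQ]]] := ae_Qn_phi0_le.
have bk := birkhoff_ergodic (measurable_sg hS) (sg_preserves hS) (sg_ergodic hS)
  (rate_integrable e0').
near=> om.
have dec : forall n, decomposed S P e (iter n sg om).
  by near: om; exact: (ae_sg hS (ae_decomposed hC3 e0')).
have nrm : forall n, normalized S P e (iter n sg om).
  by near: om; exact: (ae_sg hS (ae_normalized hC2 e0')).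
have Qle : forall N, {ae nu0 (iter N sg om), forall x,
    `|Qn e N om (phi0 om) x| <= Cf om * alpha om N * nB om (phi0 om)}.
  by near: om; apply: filterS hQ => om h N; have [] := h N e e0'.
have c0 : 0 < \int[nu e om]_x phi0 om x by near: om; exact: nu_phi0_gt0.
have bkom : n%:R^-1 * birkhoff_sum sg (fun w => ln (lam0 w) - ln (lam e w)) n om
    @[n --> \oo] --> rate e by near: om.
pose q n := \int[nu0 (iter n sg om)]_x Qn e n om (phi0 om) x.
set c := \int[nu e om]_x phi0 om x in c0.
have qcvg : q n @[n --> \oo] --> (0 : R).
  apply: (@cvg0_le_norm _ _ (fun n => Cf om * alpha om n * nB om (phi0 om))).
    rewrite -[X in _ --> X](mulr0 (Cf om * nB om (phi0 om))).
    rewrite (_ : (fun n => _) = fun n => Cf om * nB om (phi0 om) * alpha om n).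
      by apply: cvgM => //; exact: cvg_cst.
    by apply/funext => n; rewrite mulrAC.
  move=> n; have BQ := Qn_B hC3 n e0' (phi0_B hS om).
  apply: (normr_Rintegral_le (nu0_setT S _) (B_measurable hS BQ) _ (Qle n)).
  apply: mulr_ge0; first by rewrite mulr_ge0// ltW.
  exact: (nB_ge0 hS (phi0_B hS om)).
have l0 w : 0 < lam0 w by exact: (lam0_gt0 hC2).
have le0 w : 0 < lam e w by exact: (lam_gt0 hC2).
have sE n : mu0 om (surv e n om) =
    (prod_iter (lam e) n.+1 om / prod_iter lam0 n.+1 om * (c + q n.+1))%:E.
  rewrite (mu0E hS); last exact: (measurable_surv hS).
  congr EFin; have := surv_mass hS hC2 hC3 e0 dec (nrm n.+1) (phi0_B hS om).
  rewrite -/c -/(q n.+1) => h; rewrite mulrAC -h mulrAC divff ?mul1r//.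
  by rewrite gt_eqF// prod_iter_gt0.
have cq : \forall n \near \oo, 0 < c + q n.+1.
  have : c + q n.+1 @[n --> \oo] --> c.
    rewrite -[X in _ --> X]addr0; apply: cvgD; first exact: cvg_cst.
    by rewrite (cvg_shiftS q).
  by move=> /cvgr_gt; apply.
have lnc : ln (c + q n.+1) @[n --> \oo] --> ln c.
  have h : c + q n.+1 @[n --> \oo] --> c.
    rewrite -[X in _ --> X]addr0; apply: cvgD; first exact: cvg_cst.
    by rewrite (cvg_shiftS q).
  exact: (cvg_comp _ _ h (continuous_ln c0)).
pose bsum := birkhoff_sum sg (fun w => ln (lam0 w) - ln (lam e w)).
have lnE n : 0 < c + q n.+1 ->
    lne (mu0 om (surv e n om)) = (- bsum n.+1 om + ln (c + q n.+1))%:E.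
  move=> cq0; have r0 : 0 < prod_iter (lam e) n.+1 om / prod_iter lam0 n.+1 om.
    by rewrite divr_gt0// prod_iter_gt0.
  have r1 := mulr_gt0 r0 cq0.
  rewrite sE (lne_EFin r1) (lnM r0 cq0) ln_div ?posrE ?prod_iter_gt0//.
  rewrite !ln_prod_iter// /bsum /birkhoff_sum -sumrB -sumrN.
  by congr (_ + _)%:E; apply: eq_bigr => i _; rewrite opprB.
have inv0 : (n%:R^-1 : R) @[n --> \oo] --> (0 : R).
  have h : (n.+1%:R^-1 : R) @[n --> \oo] --> (0 : R) by exact: cvg_harmonic.
  by rewrite -(cvg_shiftS (fun n => n%:R^-1 : R)).
(* Survival up to time [n] involves [n.+1] factors while the rate divides by [n]; the factor
   [1 + 1 / n] is the quotient [n.+1 / n]. *)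
pose g n := (1 + n%:R^-1) * - (n.+1%:R^-1 * bsum n.+1 om) + n%:R^-1 * ln (c + q n.+1).
have gcvg : g n @[n --> \oo] --> - rate e.
  rewrite -[- rate e]addr0 -[- rate e]mul1r -(mul0r (ln c)); apply: cvgD; last exact: cvgM.
  apply: cvgM.
    by rewrite -[X in _ --> X]addr0; apply: cvgD => //; exact: cvg_cst.
  by apply: cvgN; rewrite (cvg_shiftS (fun n => n%:R^-1 * bsum n om)).
have main : ((n%:R^-1)%:E * lne (mu0 om (surv e n om)))%E @[n --> \oo] --> (- rate e)%:E.
  have : (g n)%:E @[n --> \oo] --> (- rate e)%:E by apply: cvg_EFin => //; exact: nearW.
  apply: cvg_trans; apply: near_eq_cvg; apply: filterS2 cq (nbhs_infty_gt 0%N) => n cq0 n0.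
  rewrite lnE// -EFinM; congr EFin; rewrite /g mulrDr; congr (_ + _).
  rewrite mulrN mulrN; congr (- _); rewrite mulrA; congr (_ * _).
  have nN0 : n%:R != 0 :> R by rewrite pnatr_eq0 -lt0n.
  have n1N0 : n.+1%:R != 0 :> R by rewrite pnatr_eq0.
  by apply: (mulIf n1N0); rewrite divfK// -natr1 mulrDr mulVf// mulr1.
by split; rewrite /lower_rate /upper_rate (cvg_limn_einf_sup main) EFinN oppeK.
Unshelve. all: by end_near. Qed.

End limits.

(** * Escape rates for proportional holes *)

Section scaling.
Context {R : realType} {dO : measure_display} {Om : measurableType dO}
  {X : completePseudoMetricType R}.
Variables (m : probability Om R) (S : system_data Om X) (P : perturbation_data Om X).
Hypothesis hS : random_open_system m S.
Implicit Types (e : R) (om : Om) (f h : X -> R).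

Local Notation sg := (sg S).
Local Notation J := (J S).
Local Notation B := (B S).
Local Notation lam0 := (lam0 S).
Local Notation H := (H S).
Local Notation mu0 := (mu0 S).
Local Notation lam := (lam P).
Local Notation phi := (phi P).
Local Notation hole_mass := (hole_mass S P).
Local Notation muH := (muH S).
Local Notation rate := (rate m S P).
Hypothesis hC2 : cond_C2 m S P.
Hypothesis hC3 : cond_C3 m S P.
Hypothesis hC4 : cond_C4 m S P.
Hypothesis hC5 : cond_C5 m S P.
Hypothesis hC6 : cond_C6 m S.
Hypothesis hC7 : cond_C7 m S P.
Hypothesis hC8 : cond_C8 m S.
Variables (A : Om -> R) (kappa : R -> R) (t : Om -> R) (xi : R -> Om -> R) (C d : R).
Hypothesis hA : m.-integrable setT (EFin \o A).
Hypothesis ht : t \in Lfun m +oo%E.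
Hypothesis ht0 : {ae m, forall om, 0 < t om}.
Hypothesis hxi0 : {ae m, forall om, xi e om @[e --> 0^'+] --> (0 : R)}.
Hypothesis C0 : 0 < C.
Hypothesis d0 : 0 < d.
Hypothesis hAbound : {ae m, forall om, forall e, 0 < e < d ->
  (0 < mu0 om (H e om))%E -> (ln (lam0 om) - ln (lam e om)) / muH e om <= A om}.
Hypothesis hkappa : forall e, 0 < e < d -> 0 < kappa e.
Hypothesis hmu : {ae m, forall om, forall e, 0 < e < d ->
  mu0 om (H e om) = ((t om + xi e om) / kappa e)%:E}.
Hypothesis hxit : {ae m, forall om, forall e, 0 < e < d -> `|xi e om| < C * t om}.
Hypothesis hphi_ge0 : forall e, 0 < e < d ->
  (0 <= ess_inf m (fun om => ereal_inf [set (phi e om x)%:E | x in J om]))%E.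

(** As [t > 0] and [xi] tends to 0, all sufficiently small holes have positive mass, and every
    larger hole contains one of them. *)
Lemma ae_Omega_plus : {ae m, forall om, Omega_plus S om}.
Proof.
apply: filterS3 (filterI ht0 hxi0) hmu hxit => om [t0 xi0] hm _ e e0.
have tx : \forall e' \near 0^'+, 0 < t om + xi e' om.
  have : t om + xi e' om @[e' --> 0^'+] --> t om.
    by rewrite -[X in _ --> X]addr0; apply: cvgD => //; exact: cvg_cst.
  by move=> /cvgr_gt; apply.
have de : 0 < Num.min d e by rewrite lt_min d0.
have [e' [e'd e'tx]] := filter_ex (filterI (near_lt_at_right de) tx).
move: e'd; rewrite lt_min => /andP[e'0 /andP[e'd e'e]].
apply: (@lt_le_trans _ _ (mu0 om (H e' om))).
  by rewrite hm ?e'0// lte_fin divr_gt0// hkappa// e'0.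
apply: (mu0_le hS); [exact: (measurable_H hS)|exact: (measurable_H hS)|].
by move=> x; apply: (axA hS) => //; exact: ltW.
Qed.

(** The sign of [phi e] is what gives the logarithmic drop the lower bound 0 in the domination. *)
Lemma hole_mass_ge0 e : 0 < e < d -> {ae m, forall om, 0 <= hole_mass e om}.
Proof.
move=> ed; have := hphi_ge0 ed; move=> /ess_infP; apply: filterS => om h.
apply: Rintegral_ge0 => x _; rewrite indicE.
case: (boolP (x \in H e om)); last by rewrite mulr0.
rewrite inE mulr1 => /(hole_J0 hS (proj1 (andP ed))) Jx.
by rewrite -lee_fin; apply: le_trans h _; apply: ereal_inf_lbound; exists x.
Qed.

(** With [x] the hole mass, [lam_drop] makes the logarithmic drop equal to [- ln (1 - x)]. Both
    bounds are [ln (1 + y) <= y], for [y = - x] and for [y = x / (1 - x)]. *)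
Lemma ln_drop_bounds e om : 0 < e -> normalized S P e om -> normalized S P e (sg om) ->
  hole_mass e om < 1 /\
  hole_mass e om <= ln (lam0 om) - ln (lam e om) <= hole_mass e om / (1 - hole_mass e om).
Proof.
move=> e0 n1 n2; have l0 := lam0_gt0 hC2 om; have le0 := lam_gt0 hC2 (ltW e0) om.
have E := lam_drop hS hC2 e0 n1 n2.
have x1 : 0 < 1 - hole_mass e om by rewrite -(pmulr_rgt0 _ l0) -E.
split; first by rewrite -subr_gt0.
rewrite E lnM ?posrE// opprD addrA subrr sub0r; move: x1.
set x := hole_mass e om => x1.
apply/andP; split.
  rewrite lerNr; have := @le_ln1Dx R (- x); apply; lra.
rewrite -lnV ?posrE// [in leLHS](_ : (1 - x)^-1 = 1 + x / (1 - x)); last first.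
  by apply: (mulIf (lt0r_neq0 x1)); rewrite mulVf ?lt0r_neq0// mulrDl divfK ?lt0r_neq0//; ring.
apply: le_ln1Dx; rewrite ltr_pdivlMr//; lra.
Qed.

(** * Dominated convergence of the scaled drop *)

Section sequence.
Variable v : nat -> R.
Hypothesis vd : forall k, 0 < v k < d.
Hypothesis vcvg : v k @[k --> \oo] --> 0^'+.

Let v0 k : 0 < v k. Proof. by case/andP: (vd k). Qed.

(** Since [kappa] is constant in [w], the integral of [F k] is [rate (v k) * kappa (v k)].
    Pointwise, [F k] is the ratio of drop to hole mass times [muH * kappa = t + xi]. *)
Let F k w := (ln (lam0 w) - ln (lam (v k) w)) * kappa (v k).

Let mF k : measurable_fun setT (F k).
Proof.
have := rate_integrable hS hC2 (ltW (v0 k)); move=> /measurable_int/measurable_EFinP h.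
by apply: measurable_funM.
Qed.

(** The ratio of drop to hole mass lies between [hole_mass / muH] and the same quantity divided by
    [1 - hole_mass], so it shares the limit [theta0]; it is nonnegative and at most [A]. The other
    factor [s = t + xi] tends to [t] and is at most [(1 + C) * t]. *)
Let ae_F : {ae m, forall om, [/\ cvgn (series (fun k => qhat0 S k om)),
  F k om @[k --> \oo] --> theta0 S om * t om &
  forall k, exists2 s, 0 <= s <= (1 + C) * t om &
    [/\ 0 <= F k om & F k om <= A om * s]]}.
Proof.
near=> om.
have t0 : 0 < t om by near: om.
have xi0 : xi e om @[e --> 0^'+] --> (0 : R) by near: om.
have hm : forall e, 0 < e < d -> mu0 om (H e om) = ((t om + xi e om) / kappa e)%:E.
  by near: om.
have hx : forall e, 0 < e < d -> `|xi e om| < C * t om by near: om.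
have hAb : forall e, 0 < e < d ->
  (0 < mu0 om (H e om))%E -> (ln (lam0 om) - ln (lam e om)) / muH e om <= A om.
  by near: om.
have Op : Omega_plus S om by near: om; exact: ae_Omega_plus.
have nrm : forall k n, normalized S P (v k) (iter n sg om).
  by near: om; apply: ae_foralln => k; apply: (ae_sg hS); exact: (ae_normalized hC2 (ltW (v0 k))).
have hm0 : forall k, 0 <= hole_mass (v k) om.
  by near: om; apply: ae_foralln => k; exact: hole_mass_ge0.
have [scvg thcvg] : cvgn (series (fun k => qhat0 S k om)) /\
    hole_mass (v k) om / muH (v k) om @[k --> \oo] --> theta0 S om.
  by near: om; exact: (hole_mass_ratio_cvg hS hC2 hC3 hC4 hC5 hC6 hC7 hC8 v0 vcvg ae_Omega_plus).
have xcvg : hole_mass (v k) om @[k --> \oo] --> (0 : R).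
  by near: om; exact: (hole_mass_cvg0 hS hC2 hC5 hC6 v0 vcvg).
have muE k : muH (v k) om = (t om + xi (v k) om) / kappa (v k).
  by rewrite /muH hm.
have mu_gt0 k : 0 < muH (v k) om by rewrite -(muH_gt0 hS)//; exact: Op.
have k0 k : 0 < kappa (v k) by exact: hkappa.
have tE k : muH (v k) om * kappa (v k) = t om + xi (v k) om.
  by rewrite muE divfK// gt_eqF.
have tc : muH (v k) om * kappa (v k) @[k --> \oo] --> t om.
  rewrite (funext tE : (fun k => _) = fun k => t om + xi (v k) om).
  rewrite -[X in _ --> X]addr0; apply: cvgD; first exact: cvg_cst.
  exact: (cvg_comp _ _ vcvg xi0).
have FE k : F k om = (ln (lam0 om) - ln (lam (v k) om)) / muH (v k) om
    * (muH (v k) om * kappa (v k)).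
  by rewrite /F mulrA divfK// gt_eqF.
have bd k := ln_drop_bounds (v0 k) (nrm k 0) (nrm k 1).
have ratio_ge0 k : 0 <= (ln (lam0 om) - ln (lam (v k) om)) / muH (v k) om.
  apply: divr_ge0; last exact: ltW.
  have [_ /andP[h _]] := bd k.
  exact: le_trans (hm0 k) h.
split=> //.
- rewrite (funext FE : (fun k => F k om) = fun k => _).
  apply: cvgM => //.
  apply: (squeeze_cvgr (f := fun k => hole_mass (v k) om / muH (v k) om)
    (h := fun k => hole_mass (v k) om / muH (v k) om * (1 - hole_mass (v k) om)^-1)) => //.
    apply: nearW => k; have [h1 /andP[h2 h3]] := bd k.
    by rewrite mulrAC !ler_pM2r ?invr_gt0// h2 h3.
  have inv1 : (1 - hole_mass (v k) om)^-1 @[k --> \oo] --> (1 : R)^-1.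
    apply: cvgV; first exact: oner_neq0.
    by rewrite -[X in _ --> X]subr0; apply: cvgB => //; exact: cvg_cst.
  by rewrite -[X in _ --> X]mulr1; apply: cvgM => //; rewrite -[X in _ --> X]invr1.
move=> k; have tx0 : 0 <= t om + xi (v k) om.
  by rewrite -tE mulr_ge0// ltW.
exists (t om + xi (v k) om).
  rewrite tx0/= mulrDl mul1r lerD2l; apply: le_trans (ler_norm _) _.
  exact/ltW/hx.
rewrite FE tE; split; first exact: mulr_ge0.
by apply: ler_wpM2r => //; apply: hAb => //; exact: Op.
Unshelve. all: by end_near. Qed.

Lemma rate_kappa_cvg_seq : exists G : Om -> R,
  [/\ m.-integrable setT (EFin \o G), {ae m, forall om, theta0 S om * t om = G om} &
      rate (v k) * kappa (v k) @[k --> \oo] --> \int[m]_w G w].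
Proof.
(* The upper limit is measurable on all of [Om] and serves as a representative of [theta0 * t], with
   which it agrees almost everywhere. *)
pose G w := fine (limn_esup (fun k => (F k w)%:E)).
have mG : measurable_fun setT G.
  apply: measurableT_comp => //; apply: measurable_fun_limn_esup => k.
  exact/measurable_EFinP.
have [M M0 tM] : exists2 M : R, 0 <= M & {ae m, forall w, `|t w| <= M}.
  move: ht; rewrite inE => /andP[_ /[!inE]/=]; rewrite /finite_norm => fy.
  have ffin : ('N[m]_+oo[EFin \o t])%E \is a fin_num by rewrite ge0_fin_numE// Lnorm_ge0.
  exists (fine ('N[m]_+oo[EFin \o t])%E); first by rewrite fine_ge0// Lnorm_ge0.
  by apply: (ae_le_Lnorm_oo (probability_setT m)); rewrite fineK.
have FG : {ae m, forall w, F k w @[k --> \oo] --> G w}.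
  apply: filterS ae_F => w [_ h _]; rewrite /G.
  have h' : (F k w)%:E @[k --> \oo] --> (theta0 S w * t w)%:E.
    by apply: cvg_EFin => //; exact: nearW.
  by rewrite (cvg_limn_einf_sup h').
have gi : m.-integrable setT (EFin \o (fun w => (1 + C) * M * `|A w|)).
  by have := integrableZl measurableT ((1 + C) * M) (integrable_abse hA).
have Fg : {ae m, forall w, forall k, `|F k w| <= (1 + C) * M * `|A w|}.
  apply: filterS2 ae_F tM => w [_ _ h] tw k; have [s /andP[s0 st] [F0 FA]] := h k.
  rewrite ger0_norm//; apply: le_trans FA _; rewrite mulrC.
  apply: (@le_trans _ _ (s * `|A w|)); first by rewrite ler_wpM2l// ler_norm.
  rewrite ler_wpM2r//; apply: le_trans st _; apply: ler_wpM2l.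
    by rewrite addr_ge0// ltW.
  exact: le_trans (ler_norm _) tw.
have [Gi Gc] := Rintegral_dominated_convergence mF mG FG gi Fg.
exists G; split=> //.
  apply: filterS2 ae_F FG => w [_ h _] h'; exact: (cvg_unique _ h h').
rewrite (_ : (fun k => _) = fun k => \int[m]_w F k w)//; apply/funext => k.
by rewrite /rate -RintegralZr//; exact: (rate_integrable hS hC2 (ltW (v0 k))).
Qed.

End sequence.

Lemma rate_kappa_cvg :
  rate e * kappa e @[e --> 0^'+] --> \int[m]_w (theta0 S w * t w).
Proof.
apply/cvg_at_rightP => u [u0 ucvg].
have [N hN] : exists N, forall k, u (k + N)%N < d.
  have /cvgrPdist_lt/(_ d d0)[N _ h] := ucvg; exists N => k.
  have := h (k + N)%N (leq_addl _ _); rewrite sub0r normrN.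
  exact: le_lt_trans (ler_norm _).
rewrite -(cvg_shiftn N).
have vd k : 0 < u (k + N)%N < d by rewrite u0/= hN.
have vcvg : u (k + N)%N @[k --> \oo] --> 0^'+.
  move=> B [r /= r0 hB]; have /cvgrPdist_lt/(_ r r0)[M _ h] := ucvg.
  exists M => // k /= Mk; apply: hB => //=.
  by apply: h; rewrite /= (leq_trans Mk) ?leq_addr.
have [G [Gi tG Gc]] := rate_kappa_cvg_seq vd vcvg.
by rewrite (ae_eq_Rintegral_nonmeasurable Gi tG).
Qed.

Lemma small_seq : exists v : nat -> R,
  (forall k, 0 < v k < d) /\ (v k @[k --> \oo] --> 0^'+).
Proof.
(* The denominators start at 2 so that every term is strictly below [d]. *)
exists (fun k => d / k.+2%:R); split=> [k|].
  by rewrite divr_gt0//= ltr_pdivrMr// ltr_pMr// ltr1n.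
move=> B [r /= r0 hB]; have [M _ h] := near_infty_natSinv_lt (PosNum (divr_gt0 r0 d0)).
exists M => // k /= Mk; apply: hB => /=; last by rewrite divr_gt0.
rewrite sub0r normrN gtr0_norm ?divr_gt0//.
have := h k.+1 (leqW Mk); rewrite /= ltr_pdivlMr// mulrC.
by [].
Qed.

Lemma theta_t_integrable : exists G : Om -> R,
  m.-integrable setT (EFin \o G) /\ {ae m, forall om, theta0 S om * t om = G om}.
Proof.
have [v [vd vcvg]] := small_seq.
by have [G [Gi tG _]] := rate_kappa_cvg_seq vd vcvg; exists G.
Qed.

Lemma ae_qhat_series_cvg : {ae m, forall om, cvgn (series (fun k => qhat0 S k om))}.
Proof.
have [v [vd vcvg]] := small_seq.
have v0 k : 0 < v k by case/andP: (vd k).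
apply: filterS (hole_mass_ratio_cvg hS hC2 hC3 hC4 hC5 hC6 hC7 hC8 v0 vcvg ae_Omega_plus).
by move=> om [].
Qed.

(* [ae_escape_rate] has an exceptional set depending on [e]; since the rates are
   monotone in [e], countably many values of [e] determine all of them. *)
Lemma ae_escape_rate_all :
  {ae m, forall om, forall e, 0 < e < d -> is_escape_rate S mu0 e om (rate e)}.
Proof.
have ae_er e : 0 < e -> {ae m, forall om, is_escape_rate S mu0 e om (rate e)}.
  exact: (ae_escape_rate hS hC2 hC3 hC4).
(* Monotonicity of [rate] is read off at a single point of [Om] where both values are realised as
   escape rates; one exists because a set of full measure is nonempty. *)
have rate_nd x y : 0 < x -> x <= y -> y < d -> rate x <= rate y.
  move=> x0 xy yd; have y0 := lt_le_trans x0 xy.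
  have PF : ProperFilter (almost_everywhere m).
    apply: ae_properfilter_algebraOfSetsType.
    exact: (eq_ind_r (fun z => 0 < z)%E lte01 (probability_setT m)).
  have [om [[hx _] [hy _]]] := @filter_ex _ _ PF _ (filterI (ae_er x x0) (ae_er y y0)).
  by rewrite -lee_fin -hx -hy; have [] := le_rates hS om x0 xy.
have [u hu] := nondecreasing_determined_by_sequence rate_nd.
have : {ae m, forall om, forall n, 0 < u n < d -> is_escape_rate S mu0 (u n) om (rate (u n))}.
  apply: ae_foralln => n; have [/ae_er|un0] := ltP 0 (u n); first by apply: filterS.
  exact: aeW.
apply: filterS => om h e ed; split.
  apply: (hu (fun e => lower_rate S mu0 e om) _ _ e ed).
    by move=> x y x0 xy _; have [] := le_rates hS om x0 xy.
  by move=> n /h[].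
apply: (hu (fun e => upper_rate S mu0 e om) _ _ e ed).
  by move=> x y x0 xy _; have [] := le_rates hS om x0 xy.
by move=> n /h[].
Qed.

(** Multiplying numerator and denominator by [kappa] turns the ratio into [rate * kappa] over
    [t + xi], whose two limits are known. *)
Lemma ae_rate_ratio_cvg :
  {ae m, forall om, rate_ratio_cvg S om ((\int[m]_w (theta0 S w * t w)) / t om)}.
Proof.
apply: filterS3 (filterI ht0 hxi0) hmu ae_escape_rate_all => om [t0 xi0] hm er.
have near_d := near_lt_at_right d0.
exists rate; split; first by apply: filterS near_d => e /er.
have h : rate e * kappa e * (t om + xi e om)^-1 @[e --> 0^'+]
    --> (\int[m]_w (theta0 S w * t w)) / t om.
  apply: cvgM; first exact: rate_kappa_cvg.
  apply: cvgV; first by rewrite gt_eqF.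
  by rewrite -[X in _ --> X]addr0; apply: cvgD => //; exact: cvg_cst.
apply: cvg_trans h; apply: near_eq_cvg; apply: filterS near_d => e ed.
by rewrite hm//= invf_div mulrA.
Qed.

End scaling.

Theorem corollary4p9 (R : realType) (dO : measure_display)
  (Om : measurableType dO) (X : completePseudoMetricType R)
  (m : probability Om R) (S : system_data Om X) (P : perturbation_data Om X)
  (hS : random_open_system m S)
  (hC1 : cond_C1 m S) (hC2 : cond_C2 m S P) (hC3 : cond_C3 m S P)
  (hC4 : cond_C4 m S P) (hC5 : cond_C5 m S P) (hC6 : cond_C6 m S)
  (hC7 : cond_C7 m S P) (hC8 : cond_C8 m S)
  (A : Om -> R) (hA : m.-integrable setT (EFin \o A))
  (hAbound : exists2 e0 : R, 0 < e0 &
     {ae m, forall om, forall e, 0 < e < e0 -> (0 < mu0 S om (H S e om))%E ->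
        (ln (lam0 S om) - ln (lam P e om)) / fine (mu0 S om (H S e om)) <= A om})
  (kappa : R -> R) (t : Om -> R) (xi : R -> Om -> R)
  (hkappa : kappa e @[e --> 0^'+] --> +oo)
  (ht : t \in Lfun m +oo%E) (ht0 : {ae m, forall om, 0 < t om})
  (hxi : forall e, 0 < e -> xi e \in Lfun m +oo%E)
  (hxi0 : {ae m, forall om, xi e om @[e --> 0^'+] --> (0 : R)})
  (hmu : exists2 e0 : R, 0 < e0 &
     {ae m, forall om, forall e, 0 < e < e0 ->
        mu0 S om (H S e om) = ((t om + xi e om) / kappa e)%:E})
  (hxit : exists2 C : R, 0 < C & exists2 e0 : R, 0 < e0 &
     {ae m, forall om, forall e, 0 < e < e0 -> `|xi e om| < C * t om}) :
  {ae m, forall om,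
     cvgn (series (fun k => qhat0 S k om)) /\
     rate_ratio_cvg S om ((\int[m]_w (theta0 S w * t w)) / t om)} /\
  ((exists c : R, {ae m, forall om, t om = c}) ->
   {ae m, forall om, rate_ratio_cvg S om (\int[m]_w theta0 S w)}).
Proof.
have [eA eA0 {}hAbound] := hAbound.
have [em em0 {}hmu] := hmu.
have [C C0 [ex ex0 {}hxit]] := hxit.
have [_ [_ _ _ hphi_ge0]] := hC7.
have kgt0 : \forall e \near 0^'+, 0 < kappa e by move/cvgryPgt : hkappa => /(_ 0).
have [dp /= dp0 hdp] := filterI hphi_ge0 kgt0.
pose d := Num.min (Num.min eA em) (Num.min ex dp).
have d0 : 0 < d by rewrite !lt_min eA0 em0 ex0 dp0.
have dP e : 0 < e < d -> [/\ 0 < e < eA, 0 < e < em, 0 < e < ex & 0 < e < dp].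
  by move=> /andP[e0]; rewrite !lt_min e0 => /andP[/andP[-> ->] /andP[-> ->]].
have hd e : 0 < e < d ->
    (0 <= ess_inf m (fun om => ereal_inf [set (phi P e om x)%:E | x in J S om]))%E /\
    0 < kappa e.
  move=> /dP[_ _ _ /andP[e0 edp]]; apply: hdp => //=.
  by rewrite sub0r normrN gtr0_norm.
have hA' : {ae m, forall om, forall e, 0 < e < d -> (0 < mu0 S om (H S e om))%E ->
    (ln (lam0 S om) - ln (lam P e om)) / muH S e om <= A om}.
  by apply: filterS hAbound => om h e /dP[? _ _ _]; exact: h.
have hk' e : 0 < e < d -> 0 < kappa e by move=> /hd[].
have hmu' : {ae m, forall om, forall e, 0 < e < d ->
    mu0 S om (H S e om) = ((t om + xi e om) / kappa e)%:E}.
  by apply: filterS hmu => om h e /dP[_ ? _ _]; exact: h.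
have hxit' : {ae m, forall om, forall e, 0 < e < d -> `|xi e om| < C * t om}.
  by apply: filterS hxit => om h e /dP[_ _ ? _]; exact: h.
have hp' e : 0 < e < d ->
    (0 <= ess_inf m (fun om => ereal_inf [set (phi P e om x)%:E | x in J S om]))%E.
  by move=> /hd[].
have ratio := ae_rate_ratio_cvg hS hC2 hC3 hC4 hC5 hC6 hC7 hC8 hA ht ht0 hxi0 C0 d0
  hA' hk' hmu' hxit' hp'.
have series_cvg := ae_qhat_series_cvg hS hC2 hC3 hC4 hC5 hC6 hC7 hC8 ht0 hxi0 d0
  hk' hmu' hxit'.
have [G [Gi tG]] := theta_t_integrable hS hC2 hC3 hC4 hC5 hC6 hC7 hC8 hA ht ht0 hxi0 C0 d0
  hA' hk' hmu' hxit' hp'.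
split; first by apply: filterS2 series_cvg ratio.
move=> [c tc]; have PF : ProperFilter (almost_everywhere m).
  apply: ae_properfilter_algebraOfSetsType.
  exact: (eq_ind_r (fun z => 0 < z)%E lte01 (probability_setT m)).
(* Positivity of [t] passes to [c] at any point of the nonempty set where both almost-everywhere
   statements hold. *)
have c0 : 0 < c.
  by have [om [<-]] := @filter_ex _ _ PF _ (filterI tc ht0).
have Gci : m.-integrable setT (EFin \o (fun w => c^-1 * G w)).
  by have := integrableZl measurableT c^-1 Gi.
have thetaG : {ae m, forall w, theta0 S w = c^-1 * G w}.
  by apply: filterS2 tc tG => w tw <-; rewrite tw mulrC mulfK// gt_eqF.
apply: filterS2 ratio tc => om h tom.
rewrite (ae_eq_Rintegral_nonmeasurable Gci thetaG) RintegralZl// mulrC -tom.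
by rewrite -(ae_eq_Rintegral_nonmeasurable Gi tG).
Qed.
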